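(* (a) Suppose that for all $t$ in a dense subset $D\subseteq\mathbb{R}_+$, the minimal solution $u\in[0,1]$ of $u+F_t(r-cu)=1$ is increasing-transversal. Then the minimal $n$-player equilibria $\rho^m_n$ Fatou converge in probability to the minimal mean field equilibrium as $n\to\infty$. (b) Analogously, suppose that for all $t$ in a dense subset $D\subseteq\mathbb{R}_+$, the maximal solution $u\in[0,1]$ of $u+F_t(r-cu)=1$ is increasing-transversal. Then the maximal $n$-player equilibria $\rho^M_n$ Fatou converge in probability to the maximal mean field equilibrium as $n\to\infty$.
   Context: ''Increasing'' means non-decreasing. $(\Omega,\mathcal{G},P)$ is a probability space with a right-continuous filtration $\mathbb{G}=(\mathcal{G}_t)_{t\ge0}$; $r\in\mathbb{R}$ and $c>0$ are constants. A family of c.d.f.s $(F_t)_{t\ge0}$, each continuous in $y$, describes the signals of both games below: $F_t(y)=P\{Y^i_t\le y\}$. $n$-player game. $(Y^i)_{i\ge1}$ are $[0,\infty)$-valued processes which are right-continuous, increasing in $t$, $\mathbb{G}$-progressively measurable, and pairwise i.i.d. with common c.d.f. $F_t$ at time $t$; the $n$-player game has players $1,\dots,n$ with signals $Y^1,\dots,Y^n$. An $n$-player equilibrium is a $\mathbb{G}$-adapted process $\rho_n$ of the form $\rho_n(t)=\#\{j\le n:\tau^j\le t\}/n$, where $\tau^1,\dots,\tau^n$ are $\mathbb{G}$-stopping times with $\tau^i=\inf\{t\ge0:\alpha^i(t)\ge r\}$, $\alpha^i(t)=Y^i_t+c\rho_n^{-i}(t)$, $\rho_n^{-i}(t)=\#\{j\ne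 i:\tau^j\le t\}/n$. The minimal (maximal) $n$-player equilibrium $\rho_n^m$ ($\rho_n^M$) is the $n$-player equilibrium with $\rho_n^m(t)\le\rho_n(t)$ (resp. $\rho_n^M(t)\ge\rho_n(t)$) for all $t$ and every $n$-player equilibrium $\rho_n$; both exist. They satisfy, for $0\le k\le n$: $\rho^m_n(t)=k/n$ iff $\#\{i:Y^i_t+ck/n\ge r\}=k$ and $\#\{i:Y^i_t+c(k-l)/n\ge r\}\ge k-l+1$ for $1\le l\le k$; and $\rho^M_n(t)=k/n$ iff $\#\{i:Y^i_t+c(k-1)/n\ge r\}=k$ and $\#\{i:Y^i_t+c(k+l-1)/n\ge r\}\le k+l-1$ for $1\le l\le n-k$. Mean field game. $(I,\mathcal{I},\lambda)$ is an atomless probability space and $(I\times\Omega,\Sigma,\mu)$ is a Fubini extension of $(I\times\Omega,\mathcal{I}\otimes\mathcal{G},\lambda\otimes P)$, i.e. a probability space extending the product such that for every $\mu$-integrable $f$ the sections $f(i,\cdot)$ and $f(\cdot,\omega)$ are integrable for a.e. $i$ and a.e. $\omega$, and both iterated integrals exist and equal $\int f\,d\mu$. For each $i\in I$, $Y^i$ is $[0,\infty)$-valued, right-continuous, increasing and $\mathbb{G}$-progressively measurable; for each $t$, $(i,\omega)\mapsto Y^i_t(\omega)$ is $\Sigma$-measurable and $(Y^i_t)_{i\in I}$ are $\lambda$-essentially pairwise i.i.d. with c.d.f. $F_t$ (for $\lambda$-a.e. $i$, $Y^i_t$ is independent of $Y^j_t$ for $\lambda$-a.e. $j$, with common c.d.f.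 $F_t$). A (deterministic) mean field equilibrium is a function $\rho:\mathbb{R}_+\to[0,1]$ such that $\rho(t)=\lambda\{i:\tau^i\le t\}$ ($P$-a.s.) for all $t\ge0$, where $\tau^i=\inf\{t:\alpha^i(t)\ge r\}$, $\alpha^i(t)=Y^i_t+c\rho(t)$, for $\lambda$-a.e. $i$. Writing $\rho^m(t)$ and $\rho^M(t)$ for the minimal and maximal solution $u\in[0,1]$ of $u+F_t(r-cu)=1$, the minimal mean field equilibrium is $t\mapsto\rho^m(t+)$ and the maximal one is $t\mapsto\rho^M(t)$. Standing assumptions: the times $\tau^i$ are a.s. finite. (They are the minimal optimizers of $\sup_\tau E[e^{r\tau}\mathbf{1}_{\{\theta^i>\tau\}\cup\{\theta^i=\infty\}}]$ over $\mathbb{G}$-stopping times, $\theta^i=\inf\{t:\int_0^t\alpha^i(s)ds=\mathcal{E}\}$ with $\mathcal{E}$ exponential and independent of $\mathbb{G}$; this value is assumed finite.) For fixed $t$, a solution $u\in[0,1]$ of $u+F_t(r-cu)=1$ is increasing-transversal if for all $\varepsilon>0$ there is $u'\in(u-\varepsilon,u)$ with $u'+F_t(r-cu')<1$ and for all $\varepsilon>0$ there is $u'\in(u,u+\varepsilon)$ with $u'+F_t(r-cu')>1$. A sequence $(\rho_n)$ of $n$-player equilibria Fatou converges in probability to a mean field equilibrium $\rho$ if there is a dense set $D'\subseteq\mathbb{R}_+$ such that $\rho_n(t)\to\rho(t)$ in probability for all $t\in D'$. *)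

(* Defs.v *)
From HB Require Import structures.
From mathcomp Require Import all_boot all_order all_algebra.
From mathcomp Require Import all_classical all_reals all_analysis.

Set Implicit Arguments.
Unset Strict Implicit.
Unset Printing Implicit Defensive.

Import Order.TTheory GRing.Theory Num.Theory.
Import numFieldNormedType.Exports.

Local Open Scope classical_set_scope.
Local Open Scope ring_scope.

(* Time runs over [0, +oo[: processes and functions of time are functions of a
   real t, of which only the values at t >= 0 are used. *)

Section TimeSets.
Variable R : realType.

Definition Rplus : set R := [set t | 0 <= t].

Definition dense_in_Rplus (D : set R) := D `<=` Rplus /\ Rplus `<=` closure D.

(* inf {t >= 0 | alpha t >= r}, with inf of the empty set equal to +oo *)
Definition hitting_time (r : R) (alpha : R -> R) : \bar R :=
  ereal_inf [set t%:E | t in [set t | 0 <= t /\ r <= alpha t]].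

End TimeSets.

Section Filtrations.
Context (R : realType) (d : measure_display) (Omega : measurableType d).
Implicit Type G : R -> set (set Omega).

Definition filtration G :=
  (forall t : R, 0 <= t -> sigma_algebra setT (G t) /\ G t `<=` measurable) /\
  (forall s t : R, 0 <= s -> s <= t -> G s `<=` G t).

Definition right_continuous_filtration G :=
  filtration G /\ forall t : R, 0 <= t -> G t = \bigcap_(s in [set s | t < s]) G s.

(* g_sigma_algebraType (G t) is Omega equipped with the sigma-algebra G t *)
Definition adapted G (X : R -> Omega -> R) := forall t : R, 0 <= t ->
  measurable_fun setT (X t : g_sigma_algebraType (G t) -> R).

Definition progressively_measurable G (X : R -> Omega -> R) :=
  forall t : R, 0 <= t ->
  measurable_fun
    ([set p | p.1 \in `[0, t]] : set (R * g_sigma_algebraType (G t)))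
    (fun p : R * g_sigma_algebraType (G t) => X p.1 p.2).

Definition stopping_time G (tau : Omega -> \bar R) :=
  (forall w, 0%E <= tau w)%E /\
  (forall t : R, 0 <= t -> G t [set w | tau w <= t%:E]%E).

Definition signal_process G (X : R -> Omega -> R) :=
  [/\ forall (t : R) w, 0 <= t -> 0 <= X t w,
      forall w (t : R), 0 <= t -> X s w @[s --> t^'+] --> X t w,
      forall w (s t : R), 0 <= s -> s <= t -> X s w <= X t w &
      progressively_measurable G X].

End Filtrations.

Section Independence.
Context (R : realType) (d : measure_display) (Omega : measurableType d).
Variable P : probability Omega R.

Definition independent_rv (X Y : Omega -> R) :=
  forall A B : set R, measurable A -> measurable B ->
  P (X @^-1` A `&` Y @^-1` B) = (P (X @^-1` A) * P (Y @^-1` B))%E.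

Definition has_cdf (X : Omega -> R) (F : R -> R) :=
  forall y, P [set w | X w <= y] = (F y)%:E.

Definition cvg_in_probability (X_ : nat -> Omega -> R) (x : R) :=
  forall e : R, 0 < e -> P [set w | e <= `|X_ n w - x|] @[n --> \oo] --> 0%E.

(* The rate is 1: this is the rate for which alpha is the hazard rate of the
   time explosion_time alpha E defined below. *)
Definition unit_exponential_independent (G : R -> set (set Omega))
    (E : {RV P >-> R}) :=
  (forall A : set R, measurable A ->
     distribution P E A = exponential_prob (1 : R) A) /\
  (forall (C : set Omega) (B : set R),
     <<s \bigcup_(t in @Rplus R) G t >> C -> measurable B ->
     P (C `&` E @^-1` B) = (P C * P (E @^-1` B))%E).

End Independence.

Section StoppingValue.
Context (R : realType) (d : measure_display) (Omega : measurableType d).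
Variables (P : probability Omega R) (G : R -> set (set Omega)).
Variables (r : R) (E : Omega -> R).
Local Open Scope ereal_scope.

Definition explosion_time (alpha : R -> Omega -> R) (w : Omega) : \bar R :=
  ereal_inf [set t%:E | t in [set t | (0 <= t)%R /\
    \int[lebesgue_measure]_(s in `[0%R, t]) (alpha s w)%:E = (E w)%:E]].

Definition payoff (alpha : R -> Omega -> R) (tau : Omega -> \bar R) : \bar R :=
  let theta := explosion_time alpha in
  \int[P]_w (expeR (r%:E * tau w) *
    (\1_([set v | (tau v < theta v)%E \/ theta v = +oo%E]) w)%:E).

Definition value (alpha : R -> Omega -> R) : \bar R :=
  ereal_sup [set payoff alpha tau | tau in stopping_time G].

End StoppingValue.

Section NPlayerGame.
Context (R : realType) (d : measure_display) (Omega : measurableType d).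
Variables (P : probability Omega R) (G : R -> set (set Omega)).
Variables (r c : R).
(* players are numbered from 0 *)
Variable Y : nat -> R -> Omega -> R.

Definition n_player_signals (F : R -> R -> R) :=
  (forall i, signal_process G (Y i)) /\
  (forall t : R, 0 <= t ->
     (forall i, has_cdf P (Y i t) (F t)) /\
     (forall i j, i <> j -> independent_rv P (Y i t) (Y j t))).

Definition stopped_fraction (n : nat) (tau : 'I_n -> Omega -> \bar R)
    (t : R) (w : Omega) : R :=
  #|[pred j : 'I_n | (tau j w <= t%:E)%E]|%:R / n%:R.

Definition stopped_fraction_others (n : nat) (tau : 'I_n -> Omega -> \bar R)
    (i : 'I_n) (t : R) (w : Omega) : R :=
  #|[pred j : 'I_n | (j != i) && (tau j w <= t%:E)%E]|%:R / n%:R.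

Definition n_player_alpha (n : nat) (tau : 'I_n -> Omega -> \bar R)
    (i : 'I_n) (t : R) (w : Omega) : R :=
  Y i t w + c * stopped_fraction_others tau i t w.

Definition n_player_equilibrium_with (n : nat) (tau : 'I_n -> Omega -> \bar R)
    (rho : R -> Omega -> R) :=
  [/\ forall i, stopping_time G (tau i),
      forall i w, tau i w = hitting_time r (n_player_alpha tau i ^~ w),
      adapted G rho &
      forall (t : R) w, 0 <= t -> rho t w = stopped_fraction tau t w].

Definition n_player_equilibrium (n : nat) (rho : R -> Omega -> R) :=
  exists tau : 'I_n -> Omega -> \bar R, n_player_equilibrium_with tau rho.

Definition minimal_n_player_equilibrium (n : nat) (rho : R -> Omega -> R) :=
  n_player_equilibrium n rho /\
  forall rho', n_player_equilibrium n rho' ->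
  forall (t : R) w, 0 <= t -> rho t w <= rho' t w.

Definition maximal_n_player_equilibrium (n : nat) (rho : R -> Omega -> R) :=
  n_player_equilibrium n rho /\
  forall rho', n_player_equilibrium n rho' ->
  forall (t : R) w, 0 <= t -> rho' t w <= rho t w.

Definition n_player_standing_assumptions (E : Omega -> R) :=
  forall n (tau : 'I_n -> Omega -> \bar R) rho,
  n_player_equilibrium_with tau rho -> forall i,
  {ae P, forall w, tau i w < +oo}%E /\
  value P G r E (n_player_alpha tau i) \is a fin_num.

End NPlayerGame.

Section MeanFieldGame.
Context (R : realType) (d : measure_display) (Omega : measurableType d).
Context (d' : measure_display) (I : measurableType d').
Variables (P : probability Omega R) (lambda : probability I R).
Variable G : R -> set (set Omega).

Definition atomless := forall A : set I, measurable A -> (0 < lambda A)%E ->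
  exists B : set I, [/\ measurable B, B `<=` A & (0 < lambda B < lambda A)%E].

(* As the spaces need not be complete, x |-> g x need only be defined a.e.:
   the function phi is integrable and is a version of the a.e. defined g. *)
Definition iterated_integral_is (e : measure_display) (T : measurableType e)
    (m : probability T R) (g : T -> \bar R) (v : \bar R) :=
  exists phi : T -> \bar R,
  [/\ m.-integrable setT phi, {ae m, forall x, phi x = g x} &
      \int[m]_x phi x = v]%E.

Definition fubini_extension (Sigma : set (set (I * Omega)))
    (mu : probability (g_sigma_algebraType Sigma) R) :=
  [/\ sigma_algebra setT Sigma,
      forall A : set (I * Omega), measurable A ->
        Sigma A /\ mu A = (lambda \x P)%E A &
      forall f : I * Omega -> R,
        mu.-integrable setT
          ((fun z => (f z)%:E) : g_sigma_algebraType Sigma -> \bar R) ->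
        [/\ {ae lambda, forall i, P.-integrable setT (fun w => (f (i, w))%:E)},
            {ae P, forall w, lambda.-integrable setT (fun i => (f (i, w))%:E)},
            iterated_integral_is lambda (fun i => \int[P]_w (f (i, w))%:E)%E
              (\int[mu]_z (f z)%:E)%E &
            iterated_integral_is P (fun w => \int[lambda]_i (f (i, w))%:E)%E
              (\int[mu]_z (f z)%:E)%E]].

Variable Y : I -> R -> Omega -> R.

Definition mean_field_signals (Sigma : set (set (I * Omega)))
    (F : R -> R -> R) :=
  (forall i, signal_process G (Y i)) /\
  (forall t : R, 0 <= t ->
     measurable_fun setT
       ((fun z => Y z.1 t z.2) : g_sigma_algebraType Sigma -> R) /\
     {ae lambda, forall i, has_cdf P (Y i t) (F t) /\
        {ae lambda, forall j, independent_rv P (Y i t) (Y j t)}}).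

Variables r c : R.

Definition mean_field_alpha (rho : R -> R) (i : I) (t : R) (w : Omega) : R :=
  Y i t w + c * rho t.

Definition mean_field_time (rho : R -> R) (i : I) (w : Omega) : \bar R :=
  hitting_time r (mean_field_alpha rho i ^~ w).

(* Measures take unspecified values on nonmeasurable sets, hence the explicit
   measurability requirement. *)
Definition mean_field_equilibrium (rho : R -> R) :=
  (forall t : R, 0 <= t -> 0 <= rho t <= 1) /\
  (forall t : R, 0 <= t -> {ae P, forall w,
     measurable [set i | mean_field_time rho i w <= t%:E]%E /\
     lambda [set i | mean_field_time rho i w <= t%:E]%E = (rho t)%:E}).

Definition minimal_mean_field_equilibrium (rho : R -> R) :=
  mean_field_equilibrium rho /\
  forall rho', mean_field_equilibrium rho' ->
  forall t : R, 0 <= t -> rho t <= rho' t.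

Definition maximal_mean_field_equilibrium (rho : R -> R) :=
  mean_field_equilibrium rho /\
  forall rho', mean_field_equilibrium rho' ->
  forall t : R, 0 <= t -> rho' t <= rho t.

Definition mean_field_standing_assumptions (E : Omega -> R) :=
  forall rho, mean_field_equilibrium rho ->
  {ae lambda, forall i,
    {ae P, forall w, mean_field_time rho i w < +oo}%E /\
    value P G r E (mean_field_alpha rho i) \is a fin_num}.

End MeanFieldGame.

Section FixedPointEquation.
Context (R : realType).
(* Ft is the c.d.f. at a fixed time *)
Variables (r c : R) (Ft : R -> R).

Definition is_solution (u : R) := 0 <= u <= 1 /\ u + Ft (r - c * u) = 1.

Definition is_minimal_solution (u : R) :=
  is_solution u /\ forall v, is_solution v -> u <= v.

Definition is_maximal_solution (u : R) :=
  is_solution u /\ forall v, is_solution v -> v <= u.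

Definition increasing_transversal (u : R) :=
  (forall e : R, 0 < e ->
     exists u', [/\ u - e < u', u' < u & u' + Ft (r - c * u') < 1]) /\
  (forall e : R, 0 < e ->
     exists u', [/\ u < u', u' < u + e & 1 < u' + Ft (r - c * u')]).

End FixedPointEquation.

Definition fatou_cvg_in_probability (R : realType) (d : measure_display)
    (Omega : measurableType d) (P : probability Omega R)
    (rho_ : nat -> R -> Omega -> R) (rho : R -> R) :=
  exists D' : set R, dense_in_Rplus D' /\
    forall t, D' t -> cvg_in_probability P (fun n => rho_ n t) (rho t).

(* Main.v *)
Require Import Defs.
From HB Require Import structures.
From mathcomp Require Import all_boot all_order all_algebra.
From mathcomp Require Import all_classical all_reals all_analysis.
From mathcomp Require Import ring lra.
From mathcomp Require Import measurable_realfun.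

Set Implicit Arguments.
Unset Strict Implicit.
Unset Printing Implicit Defensive.

Import Order.TTheory GRing.Theory Num.Theory.
Import numFieldNormedType.Exports.

Local Open Scope classical_set_scope.
Local Open Scope ring_scope.

(** Fix a time [t].  The players who have stopped by [t] in an [n]-player
equilibrium form a fixed point of a monotone best-response map on sets of
players, so the equilibrium fraction [v] is a fixed point of the empirical
function sending [v] to the fraction of players [i] with [r <= Y_i + c * v].
The signals being pairwise independent and identically distributed with a
continuous distribution, this empirical function converges to
[1 - F_t (r - c * v)], uniformly on compact sets and with high probability
([willing_fraction_uniform]).  The fixed points of the limit are the solutions
of [u + F_t (r - c * u) = 1], hence no equilibrium fraction stays in a segment
free of solutions ([equilibrium_avoids_segment]).

Below the minimal solution [u] there is no solution, so the equilibrium fraction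
cannot stay away from [u] on that side.  On the other side transversality gives
levels [u'] slightly above [u] at which strictly fewer than a fraction [u'] of
the players are willing to stop; for a large population such a level bounds the
least fixed point of the best response from above ([minimal_equilibrium_le]).
The maximal case is symmetric, with [maximal_equilibrium_gt].

On the mean field side the equilibria have to be identified.  The exact law of
large numbers ([exact_law_of_large_numbers]) is a second moment computation: in
a Fubini extension the second moment of the aggregate of a centred family is an
average of covariances, and these vanish.  It shows that a mean field
equilibrium solves the equation at every time, and conversely that every
increasing right-continuous path of solutions is a mean field equilibrium.  One
such path stays below every solution at which the transversality condition holds
([upper_crossing]) and another one runs through the maximal solutions
([last_crossing]); comparing with them shows that at a time of the given dense
set the extremal mean field equilibrium takes the extremal solution as its value
([minimal_mean_field_solution], [maximal_mean_field_solution]).  That dense set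
itself is therefore a set of times of convergence in probability. *)

(** * Entry times of increasing right-continuous paths *)

Section EntryTimes.
Variable R : realType.
Implicit Types (p : R -> bool) (t : R).

(** The right-hand condition says that [p] cannot switch on immediately after a
time at which it is off: then the infimum of the times at which [p] holds is
attained when it is finite. *)
Definition entry_predicate p :=
  (forall s t, 0 <= s -> s <= t -> p s -> p t) /\
  (forall t, 0 <= t -> \forall s \near t^'+, p s = p t).

Definition entry_time p : \bar R :=
  ereal_inf [set t%:E | t in [set t | 0 <= t /\ p t]].

Lemma entry_time_le p t : entry_predicate p -> 0 <= t ->
  (entry_time p <= t%:E)%E = p t.
Proof.
move=> [pmono pright] t0; apply/idP/idP => [|pt]; last first.
  by apply: ereal_inf_lbound; exists t.
move=> inft; have : \forall s \near t^'+, p s.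
  near=> s; have ts : (entry_time p < s%:E)%E.
    by apply: le_lt_trans inft _; rewrite lte_fin; near: s; exact: nbhs_right_gt.
  have [_ [u [u0 pu] <-]] := ereal_inf_lt ts; rewrite lte_fin => us.
  exact: pmono u0 (ltW us) pu.
move=> ps; have [s []] : exists s, p s /\ p s = p t.
  apply: (@filter_ex _ (t^'+)); near=> s; split; near: s => //; exact: pright.
by move=> + <-.
Unshelve. all: by end_near. Qed.

Lemma hitting_time_le r (alpha : R -> R) t :
    entry_predicate (fun s => r <= alpha s) -> 0 <= t ->
  (hitting_time r alpha <= t%:E)%E = (r <= alpha t).
Proof. exact: entry_time_le. Qed.

(** A strict inequality at [t] persists to the right by right-continuity and a
weak one by monotonicity. *)
Lemma entry_predicate_add (f g : R -> R) r :
    (forall s t, 0 <= s -> s <= t -> f s <= f t) ->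
    (forall t, 0 <= t -> f s @[s --> t^'+] --> f t) ->
    (forall s t, 0 <= s -> s <= t -> g s <= g t) ->
    (forall t, 0 <= t -> g s @[s --> t^'+] --> g t) ->
  entry_predicate (fun s => r <= f s + g s).
Proof.
move=> fmono fcont gmono gcont; split=> [s t s0 st|t t0].
  by move=> /le_trans; apply; rewrite lerD ?fmono ?gmono.
have [rt|rt] := leP r (f t + g t).
  near=> s; apply/idP; apply: (le_trans rt).
  have ts : t <= s by apply: ltW; near: s; exact: nbhs_right_gt.
  by rewrite lerD ?fmono ?gmono.
have fgt : f s + g s @[s --> t^'+] --> f t + g t.
  by apply: cvgD; [exact: fcont|exact: gcont].
near=> s; apply/negbTE; rewrite -ltNge.
by near: s; exact: cvgr_lt fgt _ rt.
Unshelve. all: by end_near. Qed.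

End EntryTimes.

Section Signals.
Context (R : realType) (d : measure_display) (Omega : measurableType d).
Variables (G : R -> set (set Omega)) (X : R -> Omega -> R).
Hypotheses (hG : right_continuous_filtration G) (hX : signal_process G X).

Lemma signal_measurable_filtration t : 0 <= t ->
  measurable_fun setT (X t : g_sigma_algebraType (G t) -> R).
Proof.
move=> t0; have [_ _ _ Xprog] := hX.
have := Xprog t t0.
set D := (X in measurable_fun X _) => mX.
have mD : measurable D.
  rewrite [D](_ : _ = [set` `[0, t]] `*` setT).
    by apply: measurableX => //; exact: measurable_itv.
  by apply/seteqP; split=> [[a b]|[a b]] /= => [->|[]].
apply: (@measurable_comp _ _ _ _ _ _ D
  (fun p : R * g_sigma_algebraType (G t) => X p.1 p.2) setT (pair t)) => //.
  by move=> _ [w _ <-]; rewrite /D /= in_itv /= t0 lexx.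
Qed.

Lemma signal_measurable t : 0 <= t -> measurable_fun setT (X t).
Proof.
move=> t0 _ B mB.
have := signal_measurable_filtration t0 measurableT mB.
have [[hGt _] _] := hG; have [sG GM] := hGt t t0.
rewrite -/(measurable _) setTI.
by move=> GB; apply: GM; move: GB; rewrite measurable_g_measurableTypeE.
Qed.

Lemma signal_entry_predicate (g : R -> R) r w :
    (forall s t, 0 <= s -> s <= t -> g s <= g t) ->
    (forall t, 0 <= t -> g s @[s --> t^'+] --> g t) ->
  entry_predicate (fun s => r <= X s w + g s).
Proof.
have [_ Xcont Xmono _] := hX.
by move=> gmono gcont; apply: entry_predicate_add => //;
  [move=> s t; exact: Xmono|move=> t; exact: Xcont].
Qed.

End Signals.

(** * Equilibria as fixed points of the best response *)

Section FixpointBounds.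
(* [A k] stands for the players willing to stop once [k] others have stopped *)
Variables (n : nat) (A : nat -> {set 'I_n}).
Hypothesis Amono : forall k l, (k <= l)%N -> A k \subset A l.

Definition best_response (S : {set 'I_n}) : {set 'I_n} :=
  [set i | i \in A #|S :\ i|].

Lemma best_response_mono : {homo best_response : S S' / S \subset S'}.
Proof.
move=> S S' SS'; apply/fintype.subsetP => i; rewrite !inE.
exact/(fintype.subsetP (Amono (subset_leq_card (finset.setSD _ SS')))).
Qed.

(** [A k] is then closed under the best response: a member of [A k] sees at most
[k] others in it.  So it contains the least fixed point. *)
Lemma card_fixset_best_response k :
  (#|A k| <= k)%N -> (#|fixset best_response| <= k)%N.
Proof.
move=> Akk; apply: (leq_trans _ Akk); apply: subset_leq_card; rewrite /fixset.
elim: #|_| => [|m IHm]; first exact: finset.sub0set.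
apply: fintype.subset_trans (best_response_mono IHm) _; apply/fintype.subsetP => i.
rewrite inE; apply: (fintype.subsetP (Amono _)); apply: leq_trans Akk.
by apply: subset_leq_card; exact: finset.subsetDl.
Qed.

(** Each of the more than [k] members of [A k] sees at least [k] others in it,
so [A k] is contained in its best response, hence in the greatest fixed point. *)
Lemma card_cofixset_best_response k :
  (k < #|A k|)%N -> (k < #|cofixset best_response|)%N.
Proof.
move=> kAk; apply: (leq_trans kAk); apply: subset_leq_card.
rewrite /cofixset finset.subsetC /fixset; elim: #|'I_n| => [|m IHm].
  exact: finset.sub0set.
rewrite iterS /funsetC finset.setCS; move: IHm; rewrite finset.subsetC => IHm.
apply: fintype.subset_trans _ (best_response_mono IHm); apply/fintype.subsetP => i iA.
rewrite inE; apply: (fintype.subsetP (Amono _) _ iA).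
by move: kAk; rewrite (cardsD1 i) iA.
Qed.

End FixpointBounds.

Section NPlayerEquilibria.
Context (R : realType) (d : measure_display) (Omega : measurableType d).
Variables (G : R -> set (set Omega)) (r c : R) (Y : nat -> R -> Omega -> R).
Hypotheses (hG : right_continuous_filtration G) (hc : 0 < c).
Hypothesis hY : forall i, signal_process G (Y i).
Variable n : nat.

Definition willing (t : R) (w : Omega) (v : R) : {set 'I_n} :=
  [set i : 'I_n | r <= Y i t w + c * v].

Definition player_response (t : R) (w : Omega) : {set 'I_n} -> {set 'I_n} :=
  best_response (fun k => willing t w (k%:R / n%:R)).

Lemma willing_mono t w u v : u <= v -> willing t w u \subset willing t w v.
Proof.
move=> uv; apply/fintype.subsetP => i; rewrite !inE => /le_trans; apply.
by rewrite lerD2l ler_pM2l.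
Qed.

Lemma willing_frac_mono t w (k l : nat) : (k <= l)%N ->
  willing t w (k%:R / n%:R) \subset willing t w (l%:R / n%:R).
Proof.
by move=> kl; apply: willing_mono; rewrite ler_wpM2r ?invr_ge0// ler_nat.
Qed.

Lemma player_response_mono t w :
  {homo player_response t w : S S' / S \subset S'}.
Proof. exact/best_response_mono/willing_frac_mono. Qed.

Lemma player_response_mono_time s t w S : 0 <= s -> s <= t ->
  player_response s w S \subset player_response t w S.
Proof.
move=> s0 st; apply/fintype.subsetP => i; rewrite !inE => /le_trans; apply.
by rewrite lerD2r; have [_ _ Ymono _] := hY i; exact: Ymono.
Qed.

Lemma willing_near t w v : 0 <= t ->
  \forall s \near t^'+, willing s w v = willing t w v.
Proof.
move=> t0; have : \forall s \near t^'+, forall i : 'I_n,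
    (r <= Y i s w + c * v) = (r <= Y i t w + c * v).
  apply: filter_forall => i.
  have [_] := @signal_entry_predicate _ _ _ _ _ (hY i) (fun=> c * v) r w
    (fun _ _ _ _ => lexx _) (fun t _ => cvg_cst _); exact.
by apply: filterS => s Ys; apply/setP => i; rewrite !inE Ys.
Qed.

Lemma player_response_near t w : 0 <= t ->
  \forall s \near t^'+, player_response s w = player_response t w.
Proof.
move=> t0; have : \forall s \near t^'+, forall k : 'I_n.+1,
    willing s w (k%:R / n%:R) = willing t w (k%:R / n%:R).
  by apply: filter_forall => k; exact: willing_near.
apply: filterS => s Ys; apply/funext => S; apply/setP => i; rewrite inE.
have Sn : (#|S :\ i| < n.+1)%N.
  by rewrite ltnS -[X in (_ <= X)%N](card_ord n) max_card.
by rewrite (Ys (Ordinal Sn)) /player_response /best_response inE.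
Qed.

(** Counting oneself or not makes no difference at a fixed point: a member keeps
its reason to stop when one more player has stopped, and for a player outside
[S] the others in [S] are all of [S]. *)
Lemma response_fixpoint_willing t w S : player_response t w S = S ->
  willing t w (#|S|%:R / n%:R) = S.
Proof.
move=> fixS; apply/setP => i; apply/idP/idP; last first.
  rewrite -{1}fixS [in X in X -> _]inE.
  apply: (fintype.subsetP (willing_frac_mono _ _ _)).
  by apply: subset_leq_card; exact: finset.subsetDl.
apply: contraLR => iS; rewrite -fixS inE in iS.
suff : S :\ i = S by move=> <-.
apply/setP => j; rewrite !inE; case: eqVneq => //= ->.
by rewrite -fixS; apply/esym/negbTE; rewrite inE.
Qed.

Lemma equilibrium_response_fixpoint rho t w :
    n_player_equilibrium G r c Y n rho -> 0 <= t ->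
  exists2 S : {set 'I_n}, player_response t w S = S &
    rho t w = #|S|%:R / n%:R.
Proof.
move=> [tau [tau_stop tau_hit _ rhoE]] t0.
pose S s : {set 'I_n} := [set j : 'I_n | (tau j w <= s%:E)%E]%SET.
have Smono s u : s <= u -> S s \subset S u.
  move=> su; apply/fintype.subsetP => j; rewrite !inE => /le_trans; apply.
  by rewrite lee_fin.
have Snear s : 0 <= s -> \forall u \near s^'+, S u = S s.
  move=> s0; have : \forall u \near s^'+, forall j : 'I_n,
      (tau j w <= u%:E)%E = (tau j w <= s%:E)%E.
    apply: filter_forall => j; have [js|sj] := leP (tau j w) s%:E.
      apply: filterS (nbhs_right_gt s) => u su.
      by apply: (le_trans js); rewrite lee_fin ltW.
    case: (tau j w) sj => [x||//]; last first.
      by move=> _; apply: nearW => u; rewrite leye_eq.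
    rewrite lte_fin => sx; apply: filterS (nbhs_right_lt sx) => u ux.
    by rewrite lee_fin; apply/negbTE; rewrite -ltNge.
  by apply: filterS => u Su; apply/setP => j; rewrite !inE Su.
exists (S t); last first.
  rewrite rhoE// /stopped_fraction; congr (_%:R / _).
  by apply: eq_card => j; rewrite !inE.
have othersE i s : stopped_fraction_others tau i s w = #|S s :\ i|%:R / n%:R.
  by congr (_%:R / _); apply: eq_card => j; rewrite !inE.
apply/setP => i; rewrite !inE tau_hit hitting_time_le//.
  by rewrite /n_player_alpha othersE.
rewrite /n_player_alpha.
apply: (@signal_entry_predicate _ _ _ _ _ (hY i)
   (fun s => c * stopped_fraction_others tau i s w)) => [s u _ su|s s0].
  rewrite ler_pM2l// !othersE ler_wpM2r ?invr_ge0// ler_nat.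
  by apply: subset_leq_card; apply: finset.setSD; exact: Smono.
by apply: cvg_near_cst; apply: filterS (Snear s s0) => u Su; rewrite !othersE Su.
Qed.

(** Any monotone choice of a fixed point of the best response, made separately at
each time and each state, is an equilibrium.  Two choices matter, the least and
the greatest fixed point. *)
Section Selection.
Variable sel : ({set 'I_n} -> {set 'I_n}) -> {set 'I_n}.
Hypothesis selK : forall T : {set 'I_n} -> {set 'I_n},
  {homo T : S S' / S \subset S'} -> T (sel T) = sel T.
Hypothesis sel_mono : forall T T' : {set 'I_n} -> {set 'I_n},
  {homo T : S S' / S \subset S'} ->
  {homo T' : S S' / S \subset S'} -> (forall S, T S \subset T' S) ->
  sel T \subset sel T'.

Definition selected t w := sel (player_response t w).

Lemma selected_entry i w : entry_predicate (fun t => i \in selected t w).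
Proof.
split=> [s t s0 st|t t0].
  apply: (fintype.subsetP (sel_mono _ _ _)) => [||S];
    [exact: player_response_mono..|exact: player_response_mono_time].
by apply: filterS (player_response_near w t0) => s Ts; rewrite /selected Ts.
Qed.

(** The best response at time [t] takes values in a finite type, and each of its
entries is determined by one of the signals at time [t]. *)
Lemma response_event (Q : set ({set 'I_n} -> {set 'I_n})) t : 0 <= t ->
  G t [set w | Q (player_response t w)].
Proof.
move=> t0; have [[hGt _] _] := hG; have [sG GM] := hGt t t0.
rewrite -(measurable_g_measurableTypeE sG).
pose f w : {ffun {set 'I_n} -> {set 'I_n}} :=
  [ffun S => player_response t w S].
have fE w : (f w : {set 'I_n} -> {set 'I_n}) = player_response t w.
  by apply/funext => S; rewrite ffunE.
rewrite (_ : [set w | _] = \bigcup_(k in [set k : {ffun _ -> _} | Q k])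
    (f @^-1` [set k])); last first.
  apply/seteqP; split=> [w Qw|w [k Qk /= fk]]; last by rewrite /= -fE fk.
  by exists (f w) => //=; rewrite fE.
apply: fin_bigcup_measurable => [|k _]; first exact: finite_finset.
rewrite (_ : _ @^-1` _ = \bigcap_(p in [set: {set 'I_n} * 'I_n])
    [set w | (p.2 \in player_response t w p.1) = (p.2 \in k p.1)]); last first.
  apply/seteqP; split=> [w /= <- p _ /=|w /= fk]; first by rewrite fE.
  by apply/ffunP => S; apply/setP => i; rewrite fE (fk (S, i)).
apply: fin_bigcap_measurable => [|[S i] _ /=]; first exact: finite_finset.
have mYi := signal_measurable_filtration (hY i) t0.
have mE : (G t).-sigma.-measurable
    [set w | r <= Y i t w + c * (#|S :\ i|%:R / n%:R)].
  rewrite (_ : [set w | _] =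
    setT `&` Y i t @^-1` [set` `[r - c * (#|S :\ i|%:R / n%:R), +oo[ ]).
    exact: (mYi measurableT _ (measurable_itv _)).
  by apply/seteqP; split=> w /=; rewrite in_itv/= andbT lerBlDr // => -[].
case: (i \in k S).
  by rewrite (_ : [set w | _] =
    [set w | r <= Y i t w + c * (#|S :\ i|%:R / n%:R)])//;
    apply/seteqP; split=> w /=; rewrite !inE.
rewrite (_ : [set w | _] =
    ~` [set w | r <= Y i t w + c * (#|S :\ i|%:R / n%:R)]).
  exact: measurableC.
by apply/seteqP; split=> w /=; rewrite !inE; [move/negbT/negP|move/negP/negbTE].
Qed.

Lemma selected_equilibrium :
  n_player_equilibrium G r c Y n (fun t w => #|selected t w|%:R / n%:R).
Proof.
pose tau i w := entry_time (fun t => i \in selected t w).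
have tauE i w t : 0 <= t -> (tau i w <= t%:E)%E = (i \in selected t w).
  by move=> t0; rewrite entry_time_le//; exact: selected_entry.
have selE t w i : 0 <= t ->
    (i \in selected t w) = (r <= n_player_alpha c Y tau i t w).
  move=> t0; rewrite -[LHS](_ : i \in player_response t w (selected t w) = _).
    rewrite !inE /n_player_alpha /stopped_fraction_others.
    congr (_ <= _ + _ * (_%:R / _)).
    by apply: eq_card => j; rewrite !inE tauE.
  by rewrite /selected selK//; exact: player_response_mono.
exists tau; split=> [i|i w|t t0|t w t0].
- split=> [w|t t0].
    apply: le_ereal_inf_tmp => _ [t [t0 _] <-]; by rewrite lee_fin.
  rewrite (_ : [set w | _] = [set w | i \in sel (player_response t w)]).
    exact: (response_event (fun T => i \in sel T)).
  by apply/seteqP; split=> w /=; rewrite tauE.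
- rewrite /tau /entry_time /hitting_time; congr (ereal_inf [set _ | _ in _]).
  by apply/seteqP; split=> t /= -[t0]; rewrite selE.
- have [[hGt _] _] := hG; have [sG GM] := hGt t t0.
  move=> _ B mB; rewrite setTI measurable_g_measurableTypeE//.
  exact: (response_event (fun T => B (#|sel T|%:R / n%:R))).
- rewrite /stopped_fraction; congr (_%:R / _).
  by apply: eq_card => j; rewrite !inE tauE.
Qed.

End Selection.

Lemma fixset_mono (T T' : {set 'I_n} -> {set 'I_n}) :
  {homo T : S S' / S \subset S'} -> {homo T' : S S' / S \subset S'} ->
  (forall S, T S \subset T' S) -> fixset T \subset fixset T'.
Proof.
move=> _ T'mono TT'; rewrite /fixset; elim: #|_| => [|m IHm].
  exact: finset.sub0set.
exact: fintype.subset_trans (TT' _) (T'mono _ _ IHm).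
Qed.

Lemma cofixset_mono (T T' : {set 'I_n} -> {set 'I_n}) :
  {homo T : S S' / S \subset S'} -> {homo T' : S S' / S \subset S'} ->
  (forall S, T S \subset T' S) -> cofixset T \subset cofixset T'.
Proof.
move=> Tmono T'mono TT'; rewrite /cofixset finset.setCS.
by apply: fixset_mono => [||S]; [exact: funsetC_mono..|rewrite finset.setCS].
Qed.

(** The minimal equilibrium lies below the one selected by the least fixed
points. *)
Lemma minimal_equilibrium_le rho t w (k : nat) :
    minimal_n_player_equilibrium G r c Y n rho -> 0 <= t ->
  (#|willing t w (k%:R / n%:R)| <= k)%N -> rho t w <= k%:R / n%:R.
Proof.
move=> [_ rhomin] t0 wk.
have := rhomin _ (selected_equilibrium (@fixsetK 'I_n) fixset_mono) t w t0.
move=> /le_trans; apply; rewrite ler_wpM2r ?invr_ge0// ler_nat.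
by apply: card_fixset_best_response wk; exact: willing_frac_mono.
Qed.

(** The maximal equilibrium lies above the one selected by the greatest fixed
points. *)
Lemma maximal_equilibrium_gt rho t w (k : nat) :
    maximal_n_player_equilibrium G r c Y n rho -> 0 <= t ->
  (k < #|willing t w (k%:R / n%:R)|)%N -> k.+1%:R / n%:R <= rho t w.
Proof.
move=> [_ rhomax] t0 wk.
have := rhomax _ (selected_equilibrium (@cofixsetK 'I_n) cofixset_mono) t w t0.
apply: le_trans; rewrite ler_wpM2r ?invr_ge0// ler_nat.
by apply: card_cofixset_best_response wk; exact: willing_frac_mono.
Qed.

End NPlayerEquilibria.

(** * The weak law of large numbers for pairwise independent events *)

Section Indicators.
Context (R : realType) (d : measure_display) (T : measurableType d).
Variable P : probability T R.

Lemma indic_Lfun2 (A : set T) : measurable A -> (\1_A : T -> R) \in Lfun P 2%:E.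
Proof.
move=> mA; rewrite inE/=; apply/andP; split; rewrite inE//=.
rewrite /finite_norm unlock poweR_lty//.
rewrite (eq_integral (fun x => (\1_A x)%:E)) => [|x _].
  by rewrite integral_indic// setIT (le_lt_trans (probability_le1 P mA))// ltry.
by rewrite /= indicE; case: (_ \in _);
  rewrite ?normr1 ?normr0 ?powR1// powR0.
Qed.

Lemma Lfun2_Lfun1 (f : T -> R) : f \in Lfun P 2%:E -> f \in Lfun P 1.
Proof. by move=> /Lfun_subset12; apply; exact: fin_num_measure. Qed.

Lemma covariance_indic (A B : set T) : measurable A -> measurable B ->
  covariance P \1_A \1_B = (P (A `&` B) - P A * P B)%E.
Proof.
move=> mA mB; have LA := indic_Lfun2 mA; have LB := indic_Lfun2 mB.
rewrite covarianceE; last 3 first.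
- exact: Lfun2_Lfun1.
- exact: Lfun2_Lfun1.
- exact: Lfun2_mul_Lfun1.
rewrite (_ : (\1_A * \1_B)%R = \1_(A `&` B)); last by rewrite indicI.
by rewrite !expectation_indic//; exact: measurableI.
Qed.

End Indicators.

Section PairwiseLawOfLargeNumbers.
Context (R : realType) (d : measure_display) (T : measurableType d).
Variables (P : probability T R) (A : nat -> set T) (p : R).
Hypothesis mA : forall i, measurable (A i).
Hypothesis PA : forall i, P (A i) = p%:E.
Hypothesis PAA : forall i j, i <> j -> P (A i `&` A j) = (p * p)%:E.

Let count n : T -> R := \sum_(i < n) \1_(A i).

Let count_Lfun2 n : count n \in Lfun P 2%:E.
Proof. by rewrite /count rpred_sum ?lee1n// => ? i _; exact: indic_Lfun2. Qed.

Let covariance_count n m : (n <= m)%N ->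
  covariance P (count n) \1_(A m) = 0%E.
Proof.
elim: n => [|n IHn] nm.
  by rewrite /count big_ord0 (covariance_cst_l P 0).
rewrite /count big_ord_recr/= covarianceDl//; last 3 first.
  exact: count_Lfun2.
  exact: indic_Lfun2.
  exact: indic_Lfun2.
rewrite IHn ?(ltnW nm)// covariance_indic// PAA ?PA ?add0e ?subee//.
by move=> nEm; move: nm; rewrite nEm ltnn.
Qed.

Let variance_count n : 'V_P[count n] = (n%:R * (p - p * p))%:E.
Proof.
elim: n => [|n IHn].
  by rewrite /count big_ord0 mul0r (variance_cst P 0).
rewrite /count big_ord_recr/= varianceD//; last 2 first.
  exact: count_Lfun2.
  exact: indic_Lfun2.
rewrite IHn covariance_count// mule0 adde0.
have -> : 'V_P[\1_(A n)] = (p - p * p)%:E.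
  by rewrite -[LHS]/(covariance P \1_(A n) \1_(A n)) covariance_indic// setIid PA.
by rewrite -EFinD -natr1 mulrDl mul1r.
Qed.

Let measurable_count n : measurable_fun setT (count n).
Proof. by have /andP[] := count_Lfun2 n; rewrite inE. Qed.

Let countE n w : \sum_(i < n) \1_(A i) w = count n w.
Proof. by rewrite /count fct_sumE. Qed.

Lemma frequency_deviation_measurable (e : R) n :
  measurable [set w | e <= `|(\sum_(i < n) \1_(A i) w) / n%:R - p|].
Proof.
rewrite (_ : [set w | _] = setT `&`
    (fun w => count n w / n%:R) @^-1` (~` `]p - e, p + e[)); last first.
  apply/seteqP; split=> w /=; rewrite countE in_itv/= -ltr_distlC distrC leNgt.
    by move=> /negP.
  by move=> -[_ /negP].
have := measurable_funM (measurable_count n) (measurable_cst (n%:R^-1 : R)).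
by apply => //; exact: measurableC (measurable_itv _).
Qed.

(** Pairwise independence is enough for the variance of the count to grow only
linearly, and Chebyshev's inequality concludes. *)
Lemma pairwise_weak_law (e : R) : 0 < e ->
  P [set w | e <= `|(\sum_(i < n) \1_(A i) w) / n%:R - p|] @[n --> \oo] --> 0%E.
Proof.
move=> e0.
have Ecount n : ('E_P[count n])%E = (n%:R * p)%:E.
  elim: n => [|n IHn].
    by rewrite /count big_ord0 mul0r (expectation_cst P 0).
  rewrite /count big_ord_recr/= expectationD ?Lfun2_Lfun1 ?indic_Lfun2//; last first.
    exact: (count_Lfun2 n).
  by rewrite IHn expectation_indic// PA -EFinD -natr1 mulrDl mul1r.
have bound n : (0 < n)%N ->
  (P [set w | (e <= `|(\sum_(i < n) \1_(A i) w) / n%:R - p|)%R]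
    <= (e ^- 2 * n%:R^-1)%:E)%E.
  move=> n0; have nR : 0 < n%:R :> R by rewrite ltr0n.
  pose X : {RV P >-> R} := mfun_Sub (mem_set (measurable_count n)).
  have := @chebyshev _ _ _ P X (n%:R * e) (mulr_gt0 nR e0).
  rewrite Ecount variance_count /=.
  rewrite (_ : [set x | _] =
    [set w | e <= `|(\sum_(i < n) \1_(A i) w) / n%:R - p|]); last first.
    apply/seteqP; split=> w /=; rewrite countE;
    rewrite -[X in n%:R * e <= `|X|](_ : n%:R * (count n w / n%:R - p) = _)
      ?normrM ?(gtr0_norm nR) ?ler_pM2l//;
    by rewrite mulrBr mulrCA divff ?mulr1// gt_eqF.
  move=> /le_trans; apply; rewrite -EFinM lee_fin.
  have -> : (n%:R * e) ^- 2 * (n%:R * (p - p * p)) =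
      e ^- 2 / n%:R * (p - p * p) :> R.
    by field; rewrite !gt_eqF.
  rewrite ler_piMr ?mulr_ge0 ?invr_ge0 ?exprn_ge0 ?(ltW e0)//.
  by have := sqr_ge0 (p - 2^-1); nra.
have eN : e ^- 2 * n%:R^-1 @[n --> \oo] --> (0 : R).
  rewrite -(mulr0 (e ^- 2)); apply: cvgMr.
  apply/gtr0_cvgV0; last exact: cvgr_idn.
  by exists 1%N => // n /= n0; rewrite ltr0n.
apply: (@squeeze_cvge _ _ _ _ (cst 0%E) _ (fun n => (e ^- 2 * n%:R^-1)%:E)).
- by exists 1%N => // n /= n0; rewrite measure_ge0 bound.
- exact: cvg_cst.
- by apply: cvg_EFin; [exact: nearW|exact: eN].
Qed.

End PairwiseLawOfLargeNumbers.

(** * Events of high probability and distribution functions *)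

Section WithHighProbability.
Context (R : realType) (d : measure_display) (Omega : measurableType d).
Variable P : probability Omega R.

(** The filter of the statements about [(n, w)] whose exceptional events have
vanishing probability.  Being a filter, it can be fed to the covering
characterization of compactness.  Exceptional sets are enlarged to measurable
ones because the statements of interest need not define measurable events. *)
Definition with_high_probability : set_system (nat * Omega) :=
  [set U | exists B : nat -> set Omega, [/\ forall n, measurable (B n),
     P (B n) @[n --> \oo] --> 0%E & forall n w, ~ B n w -> U (n, w)]].

#[global] Instance with_high_probability_filter : Filter with_high_probability.
Proof.
split.
- exists (fun=> set0); split=> //.
  by under eq_fun do rewrite measure0; exact: cvg_cst.
- move=> U V [B [mB PB BU]] [C [mC PC CV]].
  exists (fun n => B n `|` C n); split=> [n||n w /not_orP[nB nC]].
  + exact: measurableU.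
  + apply: (@squeeze_cvge _ _ _ _ (cst 0%E) _ (fun n => P (B n) + P (C n))%E).
    * by apply: nearW => n; rewrite measure_ge0/= measureU2.
    * exact: cvg_cst.
    * by rewrite -[X in _ --> X]adde0; exact: cvgeD.
  + by split; [exact: BU|exact: CV].
- move=> U V UV [B [mB PB BU]]; exists B; split=> // n w /BU; exact: UV.
Qed.

Lemma with_high_probability_near (U : set nat) :
  (\forall n \near \oo, U n) -> \forall z \near with_high_probability, U z.1.
Proof.
move=> Unear; exists (fun n => if n \in U then set0 else setT); split.
- by move=> n; case: ifP.
- apply: cvg_near_cst; apply: filterS Unear => n Un.
  by rewrite (mem_set Un) measure0.
- by move=> n w /=; case: ifPn => [/set_mem//|_ /(_ I)].
Qed.

Lemma with_high_probability_cvg (X : nat -> Omega -> R) (x : R) :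
    (forall n, (0 < n)%N -> measurable_fun setT (X n)) ->
    (forall e, 0 < e ->
      \forall z \near with_high_probability, `|X z.1 z.2 - x| < e) ->
  cvg_in_probability P X x.
Proof.
move=> mX Xx e e0; have [B [mB PB BX]] := Xx e e0.
apply: (@squeeze_cvge _ _ _ _ (cst 0%E) _ (P \o B)) => //; last exact: cvg_cst.
exists 1%N => // n /= n0; rewrite measure_ge0/= le_measure ?inE//.
  rewrite (_ : [set w | _] = setT `&` X n @^-1` (~` `]x - e, x + e[)).
    exact: mX n0 measurableT _ (measurableC (measurable_itv _)).
  apply/seteqP; split=> w /=; rewrite in_itv/= -ltr_distlC distrC leNgt.
    by move=> /negP.
  by move=> -[_ /negP].
by move=> w /= ew; apply: contrapT => /BX /=; rewrite ltNge ew.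
Qed.

End WithHighProbability.

Section CumulativeDistribution.
Context (R : realType) (d : measure_display) (Omega : measurableType d).
Variables (P : probability Omega R) (X : Omega -> R) (F : R -> R).
Hypotheses (mX : measurable_fun setT X) (FX : has_cdf P X F).

Lemma measurable_le_event y : measurable [set w | X w <= y].
Proof.
rewrite (_ : [set w | _] = setT `&` X @^-1` `]-oo, y]); first exact: mX.
by apply/seteqP; split=> w /=; rewrite in_itv/= => // -[].
Qed.

Lemma measurable_ge_event y : measurable [set w | y <= X w].
Proof.
rewrite (_ : [set w | _] = setT `&` X @^-1` `[y, +oo[); first exact: mX.
by apply/seteqP; split=> w /=; rewrite in_itv/= andbT => // -[].
Qed.

Lemma cdf_ge0_le1 y : 0 <= F y <= 1.
Proof.
rewrite -!lee_fin -FX measure_ge0 probability_le1//.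
exact: measurable_le_event.
Qed.

Lemma cdf_mono x y : x <= y -> F x <= F y.
Proof.
move=> xy; rewrite -lee_fin -!FX le_measure ?inE//;
  [exact: measurable_le_event..|move=> w /= /le_trans; exact].
Qed.

(** Continuity of [F] excludes an atom at [y]. *)
Lemma continuous_cdf_ge y : continuous F -> P [set w | y <= X w] = (1 - F y)%:E.
Proof.
move=> Fcont.
have mlt : measurable [set w | X w < y].
  rewrite (_ : [set w | _] = ~` [set w | y <= X w]).
    exact/measurableC/measurable_ge_event.
  by apply/seteqP; split=> w /=; rewrite ltNge => /negP.
suff Plt : P [set w | X w < y] = (F y)%:E.
  rewrite (_ : [set w | _] = ~` [set w | X w < y]); last first.
    by apply/seteqP; split=> w /=; rewrite leNgt => /negP.
  by rewrite probability_setC// Plt.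
apply/eqP; rewrite eq_le; apply/andP; split.
  rewrite -FX le_measure ?inE//; [exact: measurable_le_event|].
  by move=> w /= /ltW.
have Pfin : P [set w | X w < y] \is a fin_num by exact: fin_num_measure.
rewrite -(fineK Pfin) lee_fin.
rewrite leNgt; apply/negP => qF.
have Fleft : F x @[x --> y^'-] --> F y by apply: cvg_at_left_filter; exact: Fcont.
have [x [qx xy]] : exists x, fine (P [set w | X w < y]) < F x /\ x < y.
  apply: (@filter_ex _ (y^'-)); near=> x; split; near: x.
    exact: cvgr_gt Fleft _ qF.
  exact: nbhs_left_lt.
move: qx; rewrite ltNge => /negP; apply.
rewrite -lee_fin fineK// -FX le_measure ?inE//; first exact: measurable_le_event.
by move=> w /= /le_lt_trans; apply.
Unshelve. all: by end_near. Qed.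

End CumulativeDistribution.

(** * Uniform convergence of the willing fraction *)

Section WillingFraction.
Context (R : realType) (d : measure_display) (Omega : measurableType d).
Variables (P : probability Omega R) (r c : R) (Y : nat -> R -> Omega -> R).
Variables (t : R) (Ft : R -> R).
Hypothesis hc : 0 < c.
Hypothesis mY : forall i, measurable_fun setT (Y i t).
Hypothesis FY : forall i, has_cdf P (Y i t) Ft.
Hypothesis iY : forall i j, i <> j -> independent_rv P (Y i t) (Y j t).
Hypothesis Fcont : continuous Ft.

Definition willing_fraction (n : nat) (w : Omega) (v : R) : R :=
  #|willing r c Y n t w v|%:R / n%:R.

Definition willing_probability (v : R) : R := 1 - Ft (r - c * v).

Lemma willing_fraction_mono n w u v : u <= v ->
  willing_fraction n w u <= willing_fraction n w v.
Proof.
move=> uv; rewrite ler_wpM2r ?invr_ge0// ler_nat.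
by apply: subset_leq_card; exact: willing_mono.
Qed.

Lemma willing_probability_mono u v : u <= v ->
  willing_probability u <= willing_probability v.
Proof.
move=> uv; rewrite lerB// (cdf_mono (mY 0) (FY 0))// lerB// ler_wpM2l//.
exact: ltW.
Qed.

Lemma shifted_cdf_continuous : continuous (fun v => Ft (r - c * v)).
Proof.
move=> v; apply: (@continuous_comp _ _ _ (fun v => r - c * v) Ft).
  by apply: cvgB; [exact: cvg_cst|apply: cvgMr; exact: cvg_id].
exact: Fcont.
Qed.

Lemma willing_probability_continuous : continuous willing_probability.
Proof.
by move=> v; apply: cvgB; [exact: cvg_cst|exact: shifted_cdf_continuous].
Qed.

Lemma willing_fraction_pointwise v e : 0 < e ->
  \forall z \near with_high_probability P,
    `|willing_fraction z.1 z.2 v - willing_probability v| < e.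
Proof.
move=> e0; pose A i := [set w | r - c * v <= Y i t w].
have mA i : measurable (A i) by exact: measurable_ge_event.
have PA i : P (A i) = (willing_probability v)%:E.
  exact: continuous_cdf_ge.
have AE i w : (\1_(A i) w : R) = (r <= Y i t w + c * v)%R%:R.
  rewrite indicE -lerBlDr; congr (nat_of_bool _)%:R.
  by apply/idP/idP => [/set_mem//|]; rewrite inE.
have fracE n w :
    willing_fraction n w v = (\sum_(i < n) \1_(A i) w) / n%:R.
  rewrite /willing_fraction; congr (_ / _).
  rewrite -sum1_card natr_sum big_mkcond/=; apply: eq_bigr => i _.
  by rewrite AE inE; case: ifP.
exists (fun n => [set w | e <= `|(\sum_(i < n) \1_(A i) w) / n%:R
                                 - willing_probability v|]); split.
- by move=> n; exact: frequency_deviation_measurable.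
- apply: pairwise_weak_law => // i j ij.
  have Apre k : A k = Y k t @^-1` [set` `[r - c * v, +oo[].
    by apply/seteqP; split=> w /=; rewrite in_itv/= andbT.
  rewrite [in LHS]Apre [in LHS]Apre iY// -!Apre PA PA//.
- by move=> n w /= /negP; rewrite -ltNge fracE.
Qed.

(** Near a point, monotonicity traps both functions between their values at two
nearby points, where the law of large numbers applies; compactness then turns
these local bounds into a uniform one. *)
Lemma willing_fraction_uniform (K : set R) e : compact K -> 0 < e ->
  \forall z \near with_high_probability P, forall v, K v ->
    `|willing_fraction z.1 z.2 v - willing_probability v| < e.
Proof.
move=> /compact_near_coveringP cK e0.
have := cK _ (with_high_probability P) (fun z v =>
  `|willing_fraction z.1 z.2 v - willing_probability v| < e).
apply.
move=> v _; have e4 : 0 < e / 4 by rewrite divr_gt0.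
have := willing_probability_continuous (x := v).
move=> /cvgr_dist_lt /(_ _ e4) /nbhs_ballP[dl /= dl0 vdl].
pose a := v - dl / 2; pose b := v + dl / 2.
have near_v x : `|v - x| < dl ->
    `|willing_probability v - willing_probability x| < e / 4.
  by move=> vx; exact: vdl.
exists ([set x | a < x < b], [set z |
    `|willing_fraction z.1 z.2 a - willing_probability a| < e / 4 /\
    `|willing_fraction z.1 z.2 b - willing_probability b| < e / 4]).
  split=> /=; last by apply: filterI; exact: willing_fraction_pointwise.
  have : nbhs v [set` `]a, b[].
    by apply: near_in_itvoo; rewrite in_itv/= /a /b; lra.
  by apply: filterS => x; rewrite /= in_itv.
move=> [x [n w]] [/= /andP[ax xb] [fa fb]].
have pa : `|willing_probability v - willing_probability a| < e / 4.
  by apply: near_v; rewrite /a opprB addrC subrK gtr0_norm; lra.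
have pb : `|willing_probability v - willing_probability b| < e / 4.
  by apply: near_v; rewrite /b opprD addrA subrr sub0r normrN gtr0_norm; lra.
have := willing_fraction_mono n w (ltW ax).
have := willing_fraction_mono n w (ltW xb).
have := willing_probability_mono (ltW ax).
have := willing_probability_mono (ltW xb).
move: pa pb fa fb; rewrite !ltr_norml.
move=> /andP[? ?] /andP[? ?] /andP[? ?] /andP[? ?] *.
by apply/andP; split; lra.
Qed.

End WillingFraction.

(** * Convergence of the extremal equilibria at a fixed time *)

Section FixedPointCrossings.
Variables (R : realType) (r c : R) (Ft : R -> R).
Hypothesis gcont : continuous (fun v => v + Ft (r - c * v)).
Hypothesis F01 : forall y, 0 <= Ft y <= 1.

Let solution_between a b : 0 <= a -> a <= b -> b <= 1 ->
  a + Ft (r - c * a) <= 1 <= b + Ft (r - c * b) ->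
  exists2 u, a <= u <= b & is_solution r c Ft u.
Proof.
move=> a0 ab b1 /andP[ga gb].
have := @IVT R (fun v => v + Ft (r - c * v)) a b 1 ab.
have gw : {within `[a, b], continuous (fun v => v + Ft (r - c * v))}.
  exact: continuous_subspaceT.
move=> /(_ gw); rewrite ge_min ga le_max gb orbT => -[//|u].
rewrite in_itv/= => /andP[au ub] gu; exists u; first by rewrite au ub.
by split=> //; rewrite (le_trans a0 au) (le_trans ub b1).
Qed.

(** [u + Ft (r - c * u)] is at most 1 at [u = 0]; reaching 1 before the minimal
solution would create a smaller one. *)
Lemma below_minimal_solution u v : is_minimal_solution r c Ft u ->
  0 <= v -> v < u -> v + Ft (r - c * v) < 1.
Proof.
move=> [[/andP[u0 u1] _] umin] v0 vu; rewrite ltNge; apply/negP => gv.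
have [||||x /andP[x0 xv] /umin] := @solution_between 0 v; rewrite //.
- exact: ltW (lt_le_trans vu u1).
- by rewrite gv add0r; case/andP: (F01 (r - c * 0)) => _ ->.
- by move=> /le_trans/(_ xv); rewrite leNgt vu.
Qed.

(** [u + Ft (r - c * u)] is at least 1 at [u = 1]; coming back to 1 after the
maximal solution would create a larger one. *)
Lemma above_maximal_solution u v : is_maximal_solution r c Ft u ->
  u < v -> v <= 1 -> 1 < v + Ft (r - c * v).
Proof.
move=> [[/andP[u0 u1] _] umax] uv v1; rewrite ltNge; apply/negP => gv.
have [||||x /andP[vx x1] /umax] := @solution_between v 1; rewrite //.
- exact: le_trans u0 (ltW uv).
- by rewrite gv lerDl; case/andP: (F01 (r - c * 1)).
- by move=> /(le_trans vx); rewrite leNgt uv.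
Qed.

End FixedPointCrossings.

Section NPlayerConvergence.
Context (R : realType) (d : measure_display) (Omega : measurableType d).
Variables (P : probability Omega R) (G : R -> set (set Omega)) (r c : R).
Variables (F : R -> R -> R) (Y : nat -> R -> Omega -> R) (t : R).
Hypothesis hG : right_continuous_filtration G.
Hypothesis hc : 0 < c.
Hypothesis hY : n_player_signals P G Y F.
Hypothesis t0 : 0 <= t.
Hypothesis Fcont : continuous (F t).

Let sY i : signal_process G (Y i). Proof. exact: hY.1. Qed.
Let mY i : measurable_fun setT (Y i t).
Proof. exact: signal_measurable hG (sY i) _ t0. Qed.
Let FY i : has_cdf P (Y i t) (F t). Proof. exact: (hY.2 t t0).1. Qed.
Let iY i j : i <> j -> independent_rv P (Y i t) (Y j t).
Proof. exact: (hY.2 t t0).2. Qed.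
Let gcont : continuous (fun v => v + F t (r - c * v)).
Proof. by move=> v; apply: cvgD; [exact: cvg_id|exact: shifted_cdf_continuous]. Qed.
Let F01 y : 0 <= F t y <= 1.
Proof. exact: cdf_ge0_le1 (mY 0) (FY 0) y. Qed.

Lemma equilibrium_willing_fraction n rho w :
    n_player_equilibrium G r c Y n rho ->
  0 <= rho t w <= 1 /\ willing_fraction r c Y t n w (rho t w) = rho t w.
Proof.
move=> eqm; have [S fixS ->] := equilibrium_response_fixpoint hc sY w eqm t0.
split; last by rewrite /willing_fraction (response_fixpoint_willing hc fixS).
rewrite divr_ge0//=; case: n {eqm} S fixS => [|n] S _.
  by rewrite invr0 mulr0.
rewrite ler_pdivrMr ?ltr0n// mul1r ler_nat.
by rewrite -[X in (_ <= X)%N](card_ord n.+1) max_card.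
Qed.

Lemma equilibrium_measurable n rho : n_player_equilibrium G r c Y n rho ->
  measurable_fun setT (rho t).
Proof.
move=> [tau [_ _ arho _]] _ B mB.
have := arho t t0 measurableT _ mB.
have [[hGt _] _] := hG; have [sG GM] := hGt t t0.
by rewrite setTI measurable_g_measurableTypeE// => /GM.
Qed.

Let positive_population :
  \forall z \near with_high_probability P, (0 < z.1)%N.
Proof.
by apply: (@with_high_probability_near _ _ _ P [set n | (0 < n)%N]); exists 1%N.
Qed.

(** An equilibrium is a fixed point of the empirical willing fraction, which is
uniformly close to a function without fixed points on the segment. *)
Lemma equilibrium_avoids_segment (rho_ : nat -> R -> Omega -> R) a b :
    (forall n, (0 < n)%N -> n_player_equilibrium G r c Y n (rho_ n)) ->
    (forall v, a <= v <= b -> v + F t (r - c * v) != 1) ->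
  \forall z \near with_high_probability P, ~~ (a <= rho_ z.1 t z.2 <= b).
Proof.
move=> hrho gneq; have [ab|ba] := leP a b; last first.
  apply: nearW => z; apply/negP => /andP[arho rhob].
  by move: ba; rewrite ltNge (le_trans arho rhob).
pose g v := `|v + F t (r - c * v) - 1|.
have gc : continuous g.
  move=> v; apply: (@cvg_norm _ R^o).
  by apply: cvgB; [exact: gcont|exact: cvg_cst].
have [m] := EVT_min ab (continuous_subspaceT gc).
rewrite in_itv/= => abm gmin.
have gm : 0 < g m by rewrite normr_gt0 subr_eq0 gneq.
have unif := willing_fraction_uniform r hc mY FY iY Fcont
  (@segment_compact R a b) gm.
apply: filterS2 positive_population unif => -[n w] /= n0 unif.
have [_ fix_rho] := equilibrium_willing_fraction w (hrho n n0).
apply/negP => abrho.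
have := unif (rho_ n t w); rewrite in_itv/= abrho fix_rho => /(_ isT).
have := gmin (rho_ n t w); rewrite in_itv/= abrho => /(_ isT).
move=> gm_le /lt_le_trans/(_ gm_le); rewrite /g /willing_probability.
by rewrite opprB addrA ltxx.
Qed.

(** Transversality is used on the right of [u]; on the left minimality alone keeps
equilibria away. *)
Lemma minimal_equilibrium_cvg (rho_ : nat -> R -> Omega -> R) u :
    is_minimal_solution r c (F t) u -> increasing_transversal r c (F t) u ->
    (forall n, (0 < n)%N -> minimal_n_player_equilibrium G r c Y n (rho_ n)) ->
  cvg_in_probability P (fun n => rho_ n t) u.
Proof.
move=> umin [_ utr] hrho; apply: with_high_probability_cvg => [n n0|e e0].
  exact: equilibrium_measurable (hrho n n0).1.
have [[/andP[u0 u1] _] _] := umin.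
have upper : \forall z \near with_high_probability P, rho_ z.1 t z.2 < u + e.
  have [u' [uu' u'e gu']] := utr e e0.
  pose a := u' + F t (r - c * u') - 1.
  have a0 : 0 < a by rewrite subr_gt0.
  have lln := willing_fraction_pointwise r c mY FY iY Fcont u' a0.
  apply: filterS2 positive_population lln => -[n w] /= n0.
  have nR : 0 < n%:R :> R by rewrite ltr0n.
  rewrite ltr_norml => /andP[_ fracu'].
  have {}fracu' : willing_fraction r c Y t n w u' < u'.
    by move: fracu'; rewrite /willing_probability /a; lra.
  have u'0 : 0 <= n%:R * u' by rewrite mulr_ge0// (le_trans u0)// ltW.
  (* the largest number of players whose fraction is at most [u'] *)
  pose k := Num.truncn (n%:R * u').
  have kle : k%:R / n%:R <= u' by rewrite ler_pdivrMr// mulrC truncn_le.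
  apply: le_lt_trans u'e; apply: (le_trans _ kle).
  apply: (minimal_equilibrium_le hG hc sY (hrho n n0) t0).
  rewrite truncn_ge_nat//; apply: ltW; rewrite [ltRHS]mulrC -ltr_pdivrMr//.
  exact: le_lt_trans (willing_fraction_mono _ _ _ hc _ _ kle) fracu'.
have lower := @equilibrium_avoids_segment rho_ 0 (u - e)
  (fun n n0 => (hrho n n0).1).
have {}lower : \forall z \near with_high_probability P,
    ~~ (0 <= rho_ z.1 t z.2 <= u - e).
  apply: lower => v /andP[v0 vu]; rewrite lt_eqF//.
  by apply: (below_minimal_solution gcont F01 umin v0); lra.
apply: filterS3 positive_population upper lower => -[n w] /= n0 ue.
have [/andP[-> _] _] := equilibrium_willing_fraction w (hrho n n0).1.
by rewrite -ltNge/= ltr_norml => ?; apply/andP; split; lra.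
Qed.

(** Transversality is used on the left of [u]; on the right maximality alone keeps
equilibria away. *)
Lemma maximal_equilibrium_cvg (rho_ : nat -> R -> Omega -> R) u :
    is_maximal_solution r c (F t) u -> increasing_transversal r c (F t) u ->
    (forall n, (0 < n)%N -> maximal_n_player_equilibrium G r c Y n (rho_ n)) ->
  cvg_in_probability P (fun n => rho_ n t) u.
Proof.
move=> umax [utr _] hrho; apply: with_high_probability_cvg => [n n0|e e0].
  exact: equilibrium_measurable (hrho n n0).1.
have [[/andP[u0 u1] _] _] := umax.
have rho_ge0 n w : (0 < n)%N -> 0 <= rho_ n t w <= 1.
  by move=> n0; have [] := equilibrium_willing_fraction w (hrho n n0).1.
have lower : \forall z \near with_high_probability P, u - e < rho_ z.1 t z.2.
  have [u' [u'e uu' gu']] := utr e e0.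
  have [u'0|u'0] := ltP u' 0.
    apply: filterS positive_population => -[n w] /= n0.
    by have /andP[? _] := rho_ge0 n w n0; lra.
  pose a := (1 - (u' + F t (r - c * u'))) / 2.
  have a0 : 0 < a by rewrite divr_gt0// subr_gt0.
  have lln := willing_fraction_pointwise r c mY FY iY Fcont u' a0.
  have large : \forall z \near with_high_probability P, a^-1 < z.1%:R.
    apply: (@with_high_probability_near _ _ _ P [set n | a^-1 < n%:R]).
    exact: nbhs_infty_gtr.
  apply: filterS3 positive_population large lln => -[n w] /= n0 na.
  have nR : 0 < n%:R :> R by rewrite ltr0n.
  rewrite ltr_norml => /andP[fracu' _].
  have {}fracu' : u' + n%:R^-1 < willing_fraction r c Y t n w u'.
    have nVa : n%:R^-1 < a by rewrite invf_plt// posrE.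
    by move: fracu' nVa; rewrite /willing_probability /a; lra.
  (* The fraction [k / n] exceeds [u'] by at most [1 / n], and the slack [a] in the
     law of large numbers absorbs this rounding. *)
  pose k := (Num.truncn (n%:R * u')).+1.
  have u'k : u' <= k%:R / n%:R by rewrite ler_pdivlMr// mulrC ltW// truncnS_gt.
  apply: lt_le_trans u'e _; apply: (le_trans u'k).
  apply: (@le_trans _ _ (k.+1%:R / n%:R)).
    by rewrite ler_wpM2r ?invr_ge0// ler_nat.
  apply: (maximal_equilibrium_gt hG hc sY (hrho n n0) t0).
  have := lt_le_trans fracu' (willing_fraction_mono _ _ _ hc _ _ u'k).
  rewrite ltr_pdivlMr// mulrDl mulVf ?gt_eqF// => /le_lt_trans.
  rewrite -(ltr_nat R); apply.
  by rewrite /k -natr1 lerD2r mulrC truncn_le mulr_ge0.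
have upper := @equilibrium_avoids_segment rho_ (u + e) 1
  (fun n n0 => (hrho n n0).1).
have {}upper : \forall z \near with_high_probability P,
    ~~ (u + e <= rho_ z.1 t z.2 <= 1).
  apply: upper => v /andP[uv v1]; rewrite gt_eqF//.
  by apply: (above_maximal_solution gcont F01 umax _ v1); lra.
apply: filterS3 positive_population lower upper => -[n w] /= n0 ue.
have /andP[_ ->] := rho_ge0 n w n0.
by rewrite andbT -ltNge ltr_norml => ?; apply/andP; split; lra.
Qed.

End NPlayerConvergence.

(** * The exact law of large numbers on a Fubini extension *)

Section ExactLaw.
Context (R : realType) (d : measure_display) (Omega : measurableType d).
Context (d' : measure_display) (I : measurableType d').
Variables (P : probability Omega R) (lambda : probability I R).
Variables (Sigma : set (set (I * Omega))).
Variable mu : probability (g_sigma_algebraType Sigma) R.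
Hypothesis hmu : fubini_extension P lambda mu.

Definition jointly_measurable (f : I * Omega -> R) :=
  measurable_fun setT (f : g_sigma_algebraType Sigma -> R).

Lemma jointly_measurable_snd (k : Omega -> R) : measurable_fun setT k ->
  jointly_measurable (fun z => k z.2).
Proof.
move=> mk _ B mB; rewrite setTI; have [_ sub_Sigma _] := hmu.
apply: sub_sigma_algebra; apply: (sub_Sigma _ _).1.
by rewrite -[X in measurable X]setTI; apply: (measurableT_comp mk _ _).
Qed.

Lemma bounded_integrable (e : measure_display) (T : measurableType e)
    (m : probability T R) (k : T -> R) (M : R) :
  measurable_fun setT k -> (forall x, `|k x| <= M) ->
  m.-integrable setT (EFin \o k).
Proof.
move=> mk kM; apply: measurable_bounded_integrable => //.
  by rewrite (le_lt_trans (probability_le1 m measurableT))// ltry.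
exists M; split; first exact: num_real.
by move=> x Mx y _; rewrite /= (le_trans (kM y))// ltW.
Qed.

(** Both iterated integrals are equal to the integral over the Fubini extension.
*)
Lemma fubini_constant_sections (f : I * Omega -> R) (M k : R) (h : Omega -> R) :
    jointly_measurable f -> (forall z, `|f z| <= M) ->
    measurable_fun setT h ->
    {ae lambda, forall i, (\int[P]_w (f (i, w))%:E)%E = k%:E} ->
    {ae P, forall w, (\int[lambda]_i (f (i, w))%:E)%E = (h w)%:E} ->
  (\int[P]_w (h w)%:E)%E = k%:E.
Proof.
move=> mf fM mh fk fh; have [_ _ fub] := hmu.
have intf := bounded_integrable mu mf fM.
have [_ _ [phi [iphi phiE Iphi]] [psi [ipsi psiE Ipsi]]] := fub f intf.
have -> : (\int[P]_w (h w)%:E)%E = (\int[P]_w psi w)%E.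
  apply: ae_eq_integral => //; [exact/measurable_EFinP|
    exact: measurable_int ipsi|].
  by apply: filterS2 fh psiE => w fhw psiw _; rewrite psiw fhw.
rewrite Ipsi -Iphi; transitivity (\int[lambda]_i (cst k%:E) i)%E.
  apply: ae_eq_integral => //; first exact: measurable_int iphi.
  by apply: filterS2 fk phiE => i fki phii _; rewrite phii fki.
by rewrite integral_cst// -[RHS]mule1; congr (_ * _)%E; exact: probability_setT.
Qed.

(** The second moment of the aggregate [h] of [f] is the expectation, over one
index [i], of the mean of [f (i, .) * h], and that mean is in turn an average
over [j] of the means of [f (i, .) * f (j, .)], all of which vanish. *)
Lemma orthogonal_sections_aggregate (f : I * Omega -> R) (M : R) :
    jointly_measurable f -> (forall z, `|f z| <= M) ->
    (forall i, measurable_fun setT (fun w => f (i, w))) ->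
    {ae lambda, forall i, {ae lambda, forall j,
      (\int[P]_w (f (i, w) * f (j, w))%:E)%E = 0%E}} ->
  {ae P, forall w, lambda.-integrable setT (fun i => (f (i, w))%:E) /\
    (\int[lambda]_i (f (i, w))%:E)%E = 0%E}.
Proof.
move=> mf fM mfi orth; have [_ _ fub] := hmu.
have intf := bounded_integrable mu mf fM.
have [_ sec_int _ [psi [ipsi psiE _]]] := fub f intf.
(* a representative of the aggregate, bounded everywhere *)
pose h w := Num.max (- M) (Num.min M (fine (psi w))).
have M0 : 0 <= M := le_trans (normr_ge0 _) (fM point).
have hM w : `|h w| <= M.
  by rewrite ler_norml le_max lexx ge_max ge_min lexx ge0_cp.
have mh : measurable_fun setT h.
  apply: measurable_maxr => //; apply: measurable_minr => //.
  exact: measurableT_comp (measurable_int _ ipsi).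
have hE : {ae P, forall w, (\int[lambda]_i (f (i, w))%:E)%E = (h w)%:E}.
  apply: filterS2 sec_int psiE => w int_w psiw.
  have fin_w : (\int[lambda]_i (f (i, w))%:E)%E \is a fin_num.
    exact: integrable_fin_num.
  have : (`|\int[lambda]_i (f (i, w))%:E| <= M%:E)%E.
    apply: (le_trans (le_abse_integral _ _ _)) => //.
      exact: measurable_int int_w.
    apply: (@le_trans _ _ (\int[lambda]_i (cst M%:E) i)%E).
      apply: ge0_le_integral => //.
        exact/measurableT_comp/measurable_int/int_w.
      by move=> i _; rewrite /= lee_fin.
    by rewrite integral_cst//= probability_setT mule1.
  rewrite /h psiw -(fineK fin_w) lee_fin /= ler_norml => /andP[xM Mx].
  by rewrite (min_idPr Mx) (max_idPr xM).
have fhM z : `|f z * h z.2| <= M * M by rewrite normrM ler_pM.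
have mfh : jointly_measurable (fun z => f z * h z.2).
  exact: measurable_funM mf (jointly_measurable_snd mh).
have fh0 : {ae lambda, forall i, (\int[P]_w (f (i, w) * h w)%:E)%E = 0%E}.
  apply: filterS orth => i orthi.
  apply: (@fubini_constant_sections (fun z => f (i, z.2) * f z) (M * M) 0).
  - exact: measurable_funM (jointly_measurable_snd (mfi i)) mf.
  - by move=> z; rewrite normrM ler_pM.
  - exact: measurable_funM.
  - exact: orthi.
  - apply: filterS2 sec_int hE => w /= int_w hw.
    under eq_integral do rewrite EFinM.
    by rewrite integralZl// hw -EFinM.
have h2 : (\int[P]_w (h w * h w)%:E)%E = 0%E.
  apply: (fubini_constant_sections mfh fhM) => //.
    exact: measurable_funM.
  apply: filterS2 sec_int hE => w /= int_w hw.
  under eq_integral do rewrite EFinM.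
  by rewrite integralZr// hw -EFinM.
have h0 : {ae P, forall w, h w = 0}.
  have mhh : measurable_fun setT (fun w => (h w * h w)%:E).
    by apply/measurable_EFinP; exact: measurable_funM.
  have : (\int[P]_w `|(h w * h w)%:E| = 0)%E.
    rewrite -h2; apply: eq_integral => w _.
    by rewrite gee0_abs// lee_fin -expr2 sqr_ge0.
  move/(ae_eq_integral_abs P measurableT mhh).1.
  by apply: filterS => w /(_ Logic.I)/eqP; rewrite eqe mulf_eq0 orbb => /eqP.
by apply: filterS3 sec_int hE h0 => w int_w -> ->.
Qed.

(** Apply the previous lemma to the centred indicators of the events
[B (X i w)]: pairwise independence is the orthogonality of almost all pairs of
sections. *)
Theorem exact_law_of_large_numbers (X : I -> Omega -> R) (B : set R) (p : R) :
    measurable B -> (forall i, measurable_fun setT (X i)) ->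
    jointly_measurable (fun z => X z.1 z.2) ->
    {ae lambda, forall i, P (X i @^-1` B) = p%:E} ->
    {ae lambda, forall i, {ae lambda, forall j, independent_rv P (X i) (X j)}} ->
  {ae P, forall w, measurable [set i | B (X i w)] /\
    lambda [set i | B (X i w)] = p%:E}.
Proof.
move=> mB mX jX PX iX.
pose f (z : I * Omega) : R := \1_B (X z.1 z.2) - p.
have mA i : measurable (X i @^-1` B) by rewrite -[_ @^-1` _]setTI; exact: mX.
have secE i w : f (i, w) = \1_(X i @^-1` B) w - p by [].
have fM z : `|f z| <= 1 + `|p|.
  apply: (le_trans (ler_normB _ _)); rewrite lerD2r.
  by rewrite indicE; case: (_ \in _); rewrite ?normr1 ?normr0.
have jf : jointly_measurable f.
  apply: measurable_funB; last exact: measurable_cst.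
  by apply: measurableT_comp jX; exact: measurable_indic.
have mfi i : measurable_fun setT (fun w => f (i, w)).
  apply: measurable_funB; last exact: measurable_cst.
  by apply: measurableT_comp (mX i); exact: measurable_indic.
have orth : {ae lambda, forall i, {ae lambda, forall j,
    (\int[P]_w (f (i, w) * f (j, w))%:E)%E = 0%E}}.
  have PX' := PX; apply: filterS2 PX' iX => i Pi; apply: filterS2 PX => j Pj ij.
  have : covariance P \1_(X i @^-1` B) \1_(X j @^-1` B) = 0%E.
    by rewrite covariance_indic// ij// Pi Pj -EFinM subee.
  by rewrite unlock !expectation_indic// Pi Pj /= unlock.
have := orthogonal_sections_aggregate jf fM mfi orth.
apply: filterS => w [int_w sum_w].
have mAw : measurable [set i | B (X i w)].
  apply/(measurable_indicP R).
  rewrite (_ : \1_[set i | B (X i w)] = (fun i => f (i, w)) \+ cst p).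
    apply: measurable_funD; last exact: measurable_cst.
    exact/measurable_EFinP/measurable_int/int_w.
  by apply/funext => i; rewrite /f /= subrK !indicE.
split=> //; move: sum_w.
pose A := [set i | B (X i w)].
have int_A : lambda.-integrable setT (EFin \o (\1_A : I -> R)).
  by apply: (@bounded_integrable _ _ _ _ 1) => // i;
    rewrite indicE; case: (_ \in _); rewrite ?normr1 ?normr0.
have int_p : lambda.-integrable setT (EFin \o (cst p : I -> R)).
  exact: (@bounded_integrable _ _ _ _ `|p|).
have -> : (\int[lambda]_i (f (i, w))%:E = \int[lambda]_i
    ((EFin \o (\1_A : I -> R)) i - (EFin \o (cst p : I -> R)) i))%E.
  by apply: eq_integral => i _; rewrite /f /= !indicE.
rewrite integralB// integral_indic// setIT.
rewrite -[X in (_ - X)%E]/(\int[lambda]_i (cst p%:E i))%E.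
rewrite integral_cst//= probability_setT mule1.
by move/eqP; rewrite sube_eq ?add0e ?fin_num_measure// => /eqP.
Qed.

End ExactLaw.

(** * Dependence of the distribution functions on time *)

Section RightContinuity.
Variable R : realType.

Lemma nondecreasing_right_cvg (f : R -> R) (t : R) :
    (forall s s', t <= s -> s <= s' -> f s <= f s') ->
    (forall y, f t < y -> exists2 s, t < s & f s < y) ->
  f s @[s --> t^'+] --> f t.
Proof.
move=> fmono fright; apply/cvgrPdist_lt => e e0.
have [s0 ts0 fs0] := fright (f t + e) (ltr_pwDr e0 (lexx _)).
near=> s.
have ts : t <= s by apply: ltW; near: s; exact: nbhs_right_gt.
have ss0 : s <= s0 by apply: ltW; near: s; exact: nbhs_right_lt.
have := fmono t s (lexx t) ts; have := fmono s s0 ts ss0.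
by rewrite ltr_distlC => *; apply/andP; split; lra.
Unshelve. all: by end_near. Qed.

End RightContinuity.

Section CdfInTime.
Context (R : realType) (d : measure_display) (Omega : measurableType d).
Variables (P : probability Omega R) (G : R -> set (set Omega)).
Variables (X : R -> Omega -> R) (F : R -> R -> R).
Hypotheses (hG : right_continuous_filtration G) (hX : signal_process G X).
Hypothesis FX : forall t, 0 <= t -> has_cdf P (X t) (F t).
Hypothesis Fcont : forall t, 0 <= t -> continuous (F t).

Let mX t : 0 <= t -> measurable_fun setT (X t).
Proof. by move=> t0; apply: (signal_measurable hG hX). Qed.

Lemma cdf_antitone_in_time s t y : 0 <= s -> s <= t -> F t y <= F s y.
Proof.
move=> s0 st; have t0 := le_trans s0 st; have [_ _ Xmono _] := hX.
rewrite -lee_fin -!FX// le_measure ?inE//.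
- exact: measurable_le_event (mX t0) y.
- exact: measurable_le_event (mX s0) y.
- by move=> w /=; apply: le_trans; exact: Xmono.
Qed.

(** The events [X s <= y] increase, as [s] decreases to [t], to a set which
contains [X t <= x] for each [x < y]; continuity of the distribution lets [x]
tend to [y]. *)
Lemma cdf_right_continuous_in_time t y a : 0 <= t -> a < F t y ->
  exists2 s, t < s & a < F s y.
Proof.
move=> t0 aF; have [_ Xcont Xmono _] := hX.
have [x [ax xy]] : exists x, a < F t x /\ x < y.
  apply: (@filter_ex _ (y^'-)); near=> x; split; near: x.
    by apply: (@cvgr_gt _ _ _ _ _ (F t y)) => //;
      apply: cvg_at_left_filter; exact: Fcont.
  exact: nbhs_left_lt.
pose s n : R := t + n.+1%:R^-1.
have ts n : t < s n by rewrite ltrDl.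
have s0 n : 0 <= s n := le_trans t0 (ltW (ts n)).
have sdec m n : (m <= n)%N -> s n <= s m.
  by move=> mn; rewrite lerD2l lef_pV2 ?posrE// ler_nat.
pose B n := [set w | X (s n) w <= y].
have mB n : measurable (B n) by exact: measurable_le_event (mX (s0 n)) y.
have mUB : measurable (\bigcup_n B n) by exact: bigcup_measurable.
have Bmono : nondecreasing_seq B.
  move=> m n mn; apply/subsetPset => w /=; apply: le_trans.
  by apply: Xmono => //; exact: sdec.
have scvg : s n @[n --> \oo] --> t.
  by rewrite -[X in _ --> X]addr0; apply: cvgD; [exact: cvg_cst|exact: cvg_harmonic].
have BU : [set w | X t w <= x] `<=` \bigcup_n B n.
  move=> w /= Xx.
  have Xs : X (s n) w @[n --> \oo] --> X t w.
    by have /cvg_at_rightP := Xcont w t t0; apply; split.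
  have [n Xn] : exists n, X (s n) w < y.
    by apply: (@filter_ex _ \oo); apply: (cvgr_lt _ Xs); exact: le_lt_trans xy.
  by exists n => //; exact: ltW.
have PU : (a%:E < P (\bigcup_n B n))%E.
  apply: (@lt_le_trans _ _ (F t x)%:E); first by rewrite lte_fin.
  rewrite -FX// le_measure ?inE//; exact: measurable_le_event (mX t0) x.
have [n an] : exists n, (a%:E < P (B n))%E.
  apply: contrapT => /forallNP Ba; move: PU; rewrite ltNge => /negP; apply.
  apply: (cvge_to_le (nondecreasing_cvg_mu mB mUB Bmono)).
  by apply: nearW => n; rewrite leNgt; apply/negP; exact: Ba.
by exists (s n) => //; rewrite -lte_fin -FX.
Unshelve. all: by end_near. Qed.

End CdfInTime.

(** * Mean field equilibria as paths of solutions *)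

Lemma ae_witness (R : realType) (d : measure_display) (T : measurableType d)
    (m : probability T R) (Q : T -> Prop) :
  {ae m, forall x, Q x} -> exists x, Q x.
Proof.
have m0 : (0 < m setT)%E by rewrite probability_setT lte_fin ltr01.
by move=> aeQ; apply: (@filter_ex _ _ (ae_properfilter_algebraOfSetsType m0) Q).
Qed.

Section MeanFieldEquilibria.
Context (R : realType) (d : measure_display) (Omega : measurableType d).
Context (d' : measure_display) (I : measurableType d').
Variables (P : probability Omega R) (lambda : probability I R).
Variables (G : R -> set (set Omega)) (r c : R) (F : R -> R -> R).
Variables (Sigma : set (set (I * Omega))).
Variables (mu : probability (g_sigma_algebraType Sigma) R).
Variable Y : I -> R -> Omega -> R.
Hypothesis hG : right_continuous_filtration G.
Hypothesis hc : 0 < c.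
Hypothesis Fcont : forall t, 0 <= t -> continuous (F t).
Hypothesis hmu : fubini_extension P lambda mu.
Hypothesis hY : mean_field_signals P lambda G Y Sigma F.

Lemma mean_field_law t y : 0 <= t ->
  {ae P, forall w, measurable [set i | y <= Y i t w] /\
    lambda [set i | y <= Y i t w] = (1 - F t y)%:E}.
Proof.
move=> t0; have [sY lawY] := hY; have [jY aeY] := lawY t t0.
have mY i : measurable_fun setT (Y i t) by exact: (signal_measurable hG (sY i)).
have mB : measurable [set` `[y, +oo[ ] by exact: measurable_itv.
have setE (T : Type) (f : T -> R) :
    [set x | y <= f x] = [set x | [set` `[y, +oo[ ] (f x)].
  by apply/seteqP; split=> x /=; rewrite in_itv/= andbT.
have PY : {ae lambda, forall i, P (Y i t @^-1` [set` `[y, +oo[ ]) = (1 - F t y)%:E}.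
  apply: filterS aeY => i [FYi _].
  by rewrite -(continuous_cdf_ge (mY i) FYi y (Fcont t0)) setE.
have := exact_law_of_large_numbers hmu mB mY jY PY.
have iY : {ae lambda, forall i, {ae lambda, forall j,
    independent_rv P (Y i t) (Y j t)}}.
  by apply: filterS aeY => i [].
by move=> /(_ iY); apply: filterS => w; rewrite setE.
Qed.

Lemma mean_field_time_le rho t w i :
    (forall s s', 0 <= s -> s <= s' -> rho s <= rho s') ->
    (forall t, 0 <= t -> rho s @[s --> t^'+] --> rho t) ->
    0 <= t ->
  (mean_field_time Y r c rho i w <= t%:E)%E = (r - c * rho t <= Y i t w).
Proof.
move=> rhomono rhocvg t0; have [sY _] := hY.
rewrite /mean_field_time hitting_time_le// /mean_field_alpha ?lerBlDr//.
apply: (signal_entry_predicate (sY i) (g := fun s => c * rho s)).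
  by move=> s s' s0 ss'; rewrite ler_pM2l// rhomono.
by move=> s s0; apply: cvgMr; exact: rhocvg.
Qed.

Lemma mean_field_equilibrium_mono rho s t :
    mean_field_equilibrium P lambda Y r c rho -> 0 <= s -> s <= t ->
  rho s <= rho t.
Proof.
move=> [_ eqm] s0 st; have t0 := le_trans s0 st.
have [w [[ms Es] [mt Et]]] := ae_witness (filterI (eqm s s0) (eqm t t0)).
rewrite -lee_fin -Es -Et le_measure ?inE// => i /= /le_trans; apply.
by rewrite lee_fin.
Qed.

(** For almost every state, the stopped sets just after [t] decrease to the
stopped set at [t]; their masses are the values of [rho]. *)
Lemma mean_field_equilibrium_right_cvg rho t :
    mean_field_equilibrium P lambda Y r c rho -> 0 <= t ->
  rho s @[s --> t^'+] --> rho t.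
Proof.
move=> eqm t0; apply: (@nondecreasing_right_cvg R rho t) => [s s' ts ss'|y rhoy].
- exact: mean_field_equilibrium_mono eqm (le_trans t0 ts) ss'.
pose u n : R := t + n.+1%:R^-1.
have tu n : t < u n by rewrite ltrDl.
have u0 n : 0 <= u n := le_trans t0 (ltW (tu n)).
have [w [uw [mt Et]]] :=
  ae_witness (filterI (ae_foralln (fun n => eqm.2 (u n) (u0 n))) (eqm.2 t t0)).
pose A n := [set i | (mean_field_time Y r c rho i w <= (u n)%:E)%E].
have mA n : measurable (A n) := (uw n).1.
have capA : \bigcap_n A n = [set i | (mean_field_time Y r c rho i w <= t%:E)%E].
  apply/seteqP; split=> i /= Ai; last first.
    by move=> n _ /=; apply: (le_trans Ai); rewrite lee_fin ltW.
  apply/lee_addgt0Pr => e e0.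
  have [n ne] : exists n, (n.+1%:R^-1 : R) < e.
    have [N _ hN] := cvgr_lt _ (@cvg_harmonic R) _ e0.
    by exists N; exact: hN (leqnn N).
  apply: (le_trans (Ai n Logic.I)); rewrite -EFinD lee_fin lerD2l.
  exact: ltW.
have Adec : nonincreasing_seq A.
  move=> m n mn; apply/subsetPset => i /= /le_trans; apply.
  by rewrite lee_fin lerD2l lef_pV2 ?posrE// ler_nat.
have A0fin : (lambda (A 0%N) < +oo)%E.
  by rewrite (le_lt_trans (probability_le1 lambda (mA 0%N)))// ltry.
have mcapA : measurable (\bigcap_n A n) by rewrite capA.
have Acvg : lambda \o A @ \oo --> (rho t)%:E.
  by rewrite -Et -capA; exact: nonincreasing_cvg_mu.
apply: contrapT => no_s; move: rhoy; rewrite ltNge => /negP; apply.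
rewrite -lee_fin; apply: (cvge_to_ge Acvg); apply: nearW => n /=.
rewrite (uw n).2 lee_fin leNgt; apply/negP => rhou; apply: no_s.
by exists (u n).
Qed.

Lemma mean_field_equilibrium_solution rho t :
    mean_field_equilibrium P lambda Y r c rho -> 0 <= t ->
  is_solution r c (F t) (rho t).
Proof.
move=> eqm t0; split; first exact: eqm.1.
have [w [[_ Et] [_ law]]] :=
  ae_witness (filterI (eqm.2 t t0) (mean_field_law (r - c * rho t) t0)).
have setE : [set i | (mean_field_time Y r c rho i w <= t%:E)%E] =
    [set i | r - c * rho t <= Y i t w].
  apply/seteqP; split=> i /=; rewrite mean_field_time_le// => *;
    by [exact: mean_field_equilibrium_mono eqm _ _|
        exact: mean_field_equilibrium_right_cvg].
by move: Et; rewrite setE law => -[rhoE]; rewrite -{1}rhoE subrK.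
Qed.

(** Monotonicity and right-continuity make each player's hitting time pass [t]
exactly when the threshold is met at [t]; the exact law of large numbers then
turns the equation into the equilibrium condition. *)
Lemma solution_mean_field_equilibrium rho :
    (forall s t, 0 <= s -> s <= t -> rho s <= rho t) ->
    (forall t y, 0 <= t -> rho t < y -> exists2 s, t < s & rho s < y) ->
    (forall t, 0 <= t -> is_solution r c (F t) (rho t)) ->
  mean_field_equilibrium P lambda Y r c rho.
Proof.
move=> rhomono rhoright rhosol.
have rhocvg t : 0 <= t -> rho s @[s --> t^'+] --> rho t.
  move=> t0; apply: (@nondecreasing_right_cvg R rho t) => [s s' ts ss'|y].
  - by apply: rhomono => //; exact: le_trans ts.
  - exact: rhoright.
split=> t t0; first exact: (rhosol t t0).1.
apply: filterS (mean_field_law (r - c * rho t) t0) => w.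
rewrite -[in X in _ -> X](_ : [set i | r - c * rho t <= Y i t w] =
    [set i | (mean_field_time Y r c rho i w <= t%:E)%E]).
  move=> [mw ->]; split=> //; congr EFin.
  by have [_ <-] := rhosol t t0; rewrite addrK.
by apply/seteqP; split=> i /=; rewrite mean_field_time_le.
Qed.

End MeanFieldEquilibria.

(** * Two right-continuous paths of solutions *)

Section ExtremalSolutionPaths.
Variables (R : realType) (r c : R) (F : R -> R -> R).
Hypothesis hc : 0 < c.
Hypothesis F01 : forall t y, 0 <= t -> 0 <= F t y <= 1.
Hypothesis Fmono : forall t x y, 0 <= t -> x <= y -> F t x <= F t y.
Hypothesis Fanti : forall s t y, 0 <= s -> s <= t -> F t y <= F s y.
Hypothesis Fright : forall t y a, 0 <= t -> a < F t y ->
  exists2 s, t < s & a < F s y.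
Hypothesis Fcont : forall t, 0 <= t -> continuous (F t).

Let g t u := u + F t (r - c * u).

Let gcont t : 0 <= t -> continuous (g t).
Proof.
move=> t0 u; apply: cvgD; first exact: cvg_id.
by apply: shifted_cdf_continuous; exact: Fcont.
Qed.

Let g0 t : 0 <= t -> g t 0 <= 1.
Proof. by move=> t0; rewrite /g add0r; case/andP: (F01 (r - c * 0) t0). Qed.

Let g1 t : 0 <= t -> 1 <= g t 1.
Proof. by move=> t0; rewrite /g lerDl; case/andP: (F01 (r - c * 1) t0). Qed.

Let upper_set t := [set u | 0 <= u <= 1 /\ 1 < g t u] `|` [set 1].

(** The strict inequality makes this path right-continuous: as [F s y] tends to
[F t y] when [s] decreases to [t], a crossing strictly above 1 at [t] is still
one shortly after [t]. *)
Definition upper_crossing (t : R) : R := inf (upper_set t).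

Definition last_crossing (t : R) : R :=
  sup [set u | 0 <= u <= 1 /\ g t u <= 1].

Let upper_has_inf t : has_inf (upper_set t).
Proof.
split; first by exists 1; right.
by exists 0 => u [[/andP[]]//|->]; exact: ler01.
Qed.

Lemma upper_crossing_le t u : 0 <= t -> 0 <= u -> 1 < g t u ->
  upper_crossing t <= u.
Proof.
move=> t0 u0 gu; have [u1|u1] := leP u 1.
  by apply: ge_inf; [exact: (upper_has_inf t).2|left; split=> //; rewrite u0].
by apply: le_trans (ltW u1); apply: ge_inf; [exact: (upper_has_inf t).2|right].
Qed.

Let upper_crossing01 t : 0 <= upper_crossing t <= 1.
Proof.
apply/andP; split; last by apply: ge_inf; [exact: (upper_has_inf t).2|right].
apply: lb_le_inf; first exact: (upper_has_inf t).1.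
by move=> u [[/andP[]]//|->]; exact: ler01.
Qed.

Lemma upper_crossing_solution t : 0 <= t ->
  is_solution r c (F t) (upper_crossing t).
Proof.
move=> t0; split; first exact: upper_crossing01.
have /andP[s0 s1] := upper_crossing01 t; set s := upper_crossing t in s0 s1 *.
have gs := gcont t0 (x := s); apply/eqP; rewrite eq_le; apply/andP; split.
  rewrite leNgt; apply/negP => gs1.
  have [sE|sN] := eqVneq s 0.
    by move: gs1; rewrite sE ltNge => /negP; apply; exact: g0.
  have {}s0 : 0 < s by rewrite lt_neqAle eq_sym sN.
  have [u [gu [us u0]]] : exists u, 1 < g t u /\ u < s /\ 0 < u.
    apply: (@filter_ex _ (s^'-)); near=> u; split; [|split]; near: u.
    - by apply: (cvgr_gt _ (cvg_at_left_filter gs)).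
    - exact: nbhs_left_lt.
    - exact: nbhs_left_gt.
  by have := upper_crossing_le t0 (ltW u0) gu; rewrite leNgt us.
rewrite leNgt; apply/negP => gs1.
have [e /= e0 He] : \forall u \near s, g t u < 1 by exact: (cvgr_lt _ gs).
have [u uE us] := inf_adherent e0 (upper_has_inf t).
have su : s <= u by apply: ge_inf; [exact: (upper_has_inf t).2|].
have : g t u < 1.
  by apply: He => /=; rewrite ler0_norm ?subr_le0// opprB ltrBlDl.
case: uE => [[_ /ltW]|->]; first by rewrite leNgt => /negP.
by rewrite ltNge g1.
Unshelve. all: by end_near. Qed.

Lemma upper_crossing_mono s t : 0 <= s -> s <= t ->
  upper_crossing s <= upper_crossing t.
Proof.
move=> s0 st; apply: lb_le_inf; first exact: (upper_has_inf t).1.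
move=> u [[/andP[u0 _] gu]|->]; last by case/andP: (upper_crossing01 s).
apply: upper_crossing_le => //; apply: (lt_le_trans gu).
by rewrite lerD2l; exact: Fanti.
Qed.

Lemma upper_crossing_right t y : 0 <= t -> upper_crossing t < y ->
  exists2 s, t < s & upper_crossing s < y.
Proof.
move=> t0 /(inf_lt (upper_has_inf t).1)[u [[/andP[u0 _] gu]|->] uy].
  have [s ts Fs] : exists2 s, t < s & 1 - u < F s (r - c * u).
    by apply: Fright => //; rewrite ltrBlDl.
  exists s => //; apply: le_lt_trans uy; apply: upper_crossing_le => //.
    exact: le_trans t0 (ltW ts).
  by rewrite /g -ltrBlDl.
exists (t + 1); first by rewrite ltrDl.
by apply: le_lt_trans uy; case/andP: (upper_crossing01 (t + 1)).
Qed.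

Let last_has_sup t : 0 <= t -> has_sup [set u | 0 <= u <= 1 /\ g t u <= 1].
Proof.
move=> t0; split; first by exists 0; split; [rewrite lexx ler01|exact: g0].
by exists 1 => u [/andP[]].
Qed.

Lemma last_crossing_ge t u : 0 <= t -> 0 <= u <= 1 -> g t u <= 1 ->
  u <= last_crossing t.
Proof. by move=> t0 u01 gu; apply: ub_le_sup; [exact: (last_has_sup t0).2|]. Qed.

Let last_crossing01 t : 0 <= t -> 0 <= last_crossing t <= 1.
Proof.
move=> t0; rewrite last_crossing_ge ?lexx ?ler01 ?g0//=.
by apply: ge_sup; [exact: (last_has_sup t0).1|move=> u [/andP[]]].
Qed.

Lemma last_crossing_solution t : 0 <= t ->
  is_solution r c (F t) (last_crossing t).
Proof.
move=> t0; split; first exact: last_crossing01.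
have /andP[s0 s1] := last_crossing01 t0; set s := last_crossing t in s0 s1 *.
have gs := gcont t0 (x := s); apply/eqP; rewrite eq_le; apply/andP; split.
  rewrite leNgt; apply/negP => gs1.
  have [e /= e0 He] : \forall u \near s, 1 < g t u by exact: (cvgr_gt _ gs).
  have [u [u01 gu] us] := sup_adherent e0 (last_has_sup t0).
  have su : u <= s by exact: last_crossing_ge.
  move: gu; rewrite leNgt => /negP; apply.
  by apply: He => /=; rewrite ger0_norm ?subr_ge0// ltrBlDl -ltrBlDr.
rewrite leNgt; apply/negP => gs1.
have [sE|sN] := eqVneq s 1.
  by move: gs1; rewrite sE ltNge => /negP; apply; exact: g1.
have {}s1 : s < 1 by rewrite lt_neqAle sN.
have [u [gu [us u1]]] : exists u, g t u < 1 /\ s < u /\ u < 1.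
  apply: (@filter_ex _ (s^'+)); near=> u; split; [|split]; near: u.
  - by apply: (cvgr_lt _ (cvg_at_right_filter gs)).
  - exact: nbhs_right_gt.
  - exact: nbhs_right_lt.
have := @last_crossing_ge t u t0; rewrite (ltW u1) (le_trans s0 (ltW us)) (ltW gu).
by move=> /(_ isT isT); rewrite leNgt us.
Unshelve. all: by end_near. Qed.

Lemma last_crossing_mono s t : 0 <= s -> s <= t ->
  last_crossing s <= last_crossing t.
Proof.
move=> s0 st; apply: ge_sup; first exact: (last_has_sup s0).1.
move=> u [u01 gu]; apply: last_crossing_ge => //; first exact: le_trans st.
by apply: le_trans gu; rewrite lerD2l; exact: Fanti.
Qed.

(** Otherwise the right limit [L >= y] of the last crossings would still satisfy
[g t L <= 1], and would be a later crossing at [t]. *)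
Lemma last_crossing_right t y : 0 <= t -> last_crossing t < y ->
  exists2 s, t < s & last_crossing s < y.
Proof.
move=> t0 ty; apply: contrapT => no_s.
have sy s : t < s -> y <= last_crossing s.
  by move=> ts; rewrite leNgt; apply/negP => ?; apply: no_s; exists s.
pose E := [set last_crossing s | s in [set s | t < s]].
have E_inf : has_inf E.
  split; first by exists (last_crossing (t + 1)), (t + 1) => //=; rewrite ltrDl.
  by exists y => _ [s ts <-]; exact: sy.
have yL : y <= inf E.
  by apply: lb_le_inf; [exact: E_inf.1|move=> _ [s ts <-]; exact: sy].
set L := inf E in yL.
have Ls s : t < s -> L <= last_crossing s.
  by move=> ts; apply: ge_inf; [exact: E_inf.2|exists s].
have L01 : 0 <= L <= 1.
  have /andP[lt0 _] := last_crossing01 t0.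
  have t1 : t < t + 1 by rewrite ltrDl.
  have /andP[_ lt1] := last_crossing01 (le_trans t0 (ltW t1)).
  by rewrite (le_trans lt0 (ltW (lt_le_trans ty yL))) (le_trans (Ls _ t1)).
have : 1 < g t L.
  rewrite ltNge; apply/negP => gL; move: ty; rewrite ltNge => /negP; apply.
  by apply: (le_trans yL); exact: last_crossing_ge.
move=> gL.
have Fc : F t (r - c * v) @[v --> L] --> F t (r - c * L).
  exact: (shifted_cdf_continuous (Fcont t0)).
have [v [LFv Lv]] : exists v, 1 - L < F t (r - c * v) /\ L < v.
  apply: (@filter_ex _ (L^'+)); near=> v; split; near: v.
    by apply: (cvgr_gt _ (cvg_at_right_filter Fc)); rewrite ltrBlDl.
  exact: nbhs_right_gt.
have [s ts Fs] := Fright t0 LFv.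
have [_ [s' ts' <-] s'v] := inf_lt E_inf.1 Lv.
pose m := Num.min s s'.
have tm : t < m by rewrite lt_min ts ts'.
have m0 : 0 <= m := le_trans t0 (ltW tm).
have mv : last_crossing m <= v.
  by apply: le_trans (ltW s'v); apply: last_crossing_mono; rewrite ?ge_min ?lexx ?orbT.
have Fm : 1 - L < F m (r - c * v).
  by apply: (lt_le_trans Fs); apply: Fanti => //; rewrite ge_min lexx.
have [_] := last_crossing_solution m0; apply/eqP; rewrite gt_eqF//.
have FmL : F m (r - c * v) <= F m (r - c * last_crossing m).
  by apply: Fmono => //; rewrite lerB// ler_pM2l.
by have := Ls m tm; lra.
Unshelve. all: by end_near. Qed.

End ExtremalSolutionPaths.

Section ExtremalSolutions.
Variables (R : realType) (r c : R) (Ft : R -> R).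
Hypothesis Fcont : continuous Ft.

Let solutions_compact : compact [set u | is_solution r c Ft u].
Proof.
rewrite (_ : [set u | _] =
    [set` `[0, 1]] `&` (fun u => u + Ft (r - c * u)) @^-1` [set 1]); last first.
  by apply/seteqP; split=> u /=; rewrite in_itv.
apply: compact_closedI; first exact: segment_compact.
apply: closed_comp; last exact: closed_eq.
move=> u _; apply: cvgD; first exact: cvg_id.
exact: shifted_cdf_continuous.
Qed.

Lemma minimal_solution_exists u : is_solution r c Ft u ->
  exists v, is_minimal_solution r c Ft v.
Proof.
move=> su; have [] := @compact_EVT_min _ R id [set u | is_solution r c Ft u].
- by exists u.
- exact: solutions_compact.
- by apply: continuous_subspaceT => x; exact: cvg_id.
move=> v sv vmin; exists v; split; first by rewrite inE in sv.
by move=> w sw; apply: vmin; rewrite inE.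
Qed.

Lemma maximal_solution_exists u : is_solution r c Ft u ->
  exists v, is_maximal_solution r c Ft v.
Proof.
move=> su; have [] := @compact_EVT_max _ R id [set u | is_solution r c Ft u].
- by exists u.
- exact: solutions_compact.
- by apply: continuous_subspaceT => x; exact: cvg_id.
move=> v sv vmax; exists v; split; first by rewrite inE in sv.
by move=> w sw; apply: vmax; rewrite inE.
Qed.

End ExtremalSolutions.

(** * Extremal mean field equilibria and convergence *)

Section MeanFieldPaths.
Context (R : realType) (d : measure_display) (Omega : measurableType d).
Context (d' : measure_display) (I : measurableType d').
Variables (P : probability Omega R) (lambda : probability I R).
Variables (G : R -> set (set Omega)) (r c : R) (F : R -> R -> R).
Variables (Sigma : set (set (I * Omega))).
Variables (mu : probability (g_sigma_algebraType Sigma) R).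
Variables (YI : I -> R -> Omega -> R) (X : R -> Omega -> R).
Hypothesis hG : right_continuous_filtration G.
Hypothesis hc : 0 < c.
Hypothesis Fcont : forall t, 0 <= t -> continuous (F t).
Hypothesis hmu : fubini_extension P lambda mu.
Hypothesis hYI : mean_field_signals P lambda G YI Sigma F.
Hypothesis hX : signal_process G X.
Hypothesis FX : forall t, 0 <= t -> has_cdf P (X t) (F t).

Let mX t : 0 <= t -> measurable_fun setT (X t).
Proof. by move=> t0; apply: (signal_measurable hG hX). Qed.

Let F01 t y : 0 <= t -> 0 <= F t y <= 1.
Proof. by move=> t0; exact: (cdf_ge0_le1 (mX t0) (FX t0)). Qed.

Let Fmono t x y : 0 <= t -> x <= y -> F t x <= F t y.
Proof. by move=> t0; exact: (cdf_mono (mX t0) (FX t0)). Qed.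

Let Fanti s t y : 0 <= s -> s <= t -> F t y <= F s y.
Proof. exact: (cdf_antitone_in_time hG hX FX). Qed.

Let Fright t y a : 0 <= t -> a < F t y -> exists2 s, t < s & a < F s y.
Proof. exact: (cdf_right_continuous_in_time hG hX FX Fcont). Qed.

(** Transversality brings [upper_crossing] down to the minimal solution, and the
minimal equilibrium lies below [upper_crossing]. *)
Lemma minimal_mean_field_solution rho t :
    minimal_mean_field_equilibrium P lambda YI r c rho -> 0 <= t ->
    (forall u, is_minimal_solution r c (F t) u ->
      increasing_transversal r c (F t) u) ->
  is_minimal_solution r c (F t) (rho t).
Proof.
move=> [eq_rho rho_min] t0 transversal.
have rho_sol := mean_field_equilibrium_solution hG hc Fcont hmu hYI eq_rho t0.
have [u umin] := minimal_solution_exists (Fcont t0) rho_sol.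
have [_ utr] := transversal u umin.
suff -> : rho t = u by [].
apply/eqP; rewrite eq_le umin.2// andbT.
have eq_upper : mean_field_equilibrium P lambda YI r c (upper_crossing r c F).
  apply: (solution_mean_field_equilibrium hG hc Fcont hmu hYI).
  - exact: upper_crossing_mono.
  - exact: upper_crossing_right.
  - exact: upper_crossing_solution.
apply: le_trans (rho_min _ eq_upper t t0) _; apply/ler_addgt0Pr => e e0.
have [u' [uu' u'e gu']] := utr e e0.
apply: le_trans (ltW u'e); apply: upper_crossing_le => //.
by apply: le_trans (ltW uu'); have [[/andP[]]] := umin.
Qed.

(** The value of an equilibrium is a solution, hence at most the maximal one, and
[last_crossing] is an equilibrium above every solution. *)
Lemma maximal_mean_field_solution rho t :
    maximal_mean_field_equilibrium P lambda YI r c rho -> 0 <= t ->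
  is_maximal_solution r c (F t) (rho t).
Proof.
move=> [eq_rho rho_max] t0.
have rho_sol := mean_field_equilibrium_solution hG hc Fcont hmu hYI eq_rho t0.
have [u umax] := maximal_solution_exists (Fcont t0) rho_sol.
suff -> : rho t = u by [].
apply/eqP; rewrite eq_le umax.2//=.
have eq_last : mean_field_equilibrium P lambda YI r c (last_crossing r c F).
  apply: (solution_mean_field_equilibrium hG hc Fcont hmu hYI).
  - exact: last_crossing_mono.
  - exact: last_crossing_right.
  - exact: last_crossing_solution.
apply: le_trans _ (rho_max _ eq_last t t0); have [[u01 gu] _] := umax.
by apply: last_crossing_ge => //; rewrite gu.
Qed.

End MeanFieldPaths.

Theorem theorem5p4 (R : realType)
    (d : measure_display) (Omega : measurableType d) (P : probability Omega R)
    (G : R -> set (set Omega)) (r c : R) (F : R -> R -> R)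
    (E : {RV P >-> R})
    (Y : nat -> R -> Omega -> R)
    (d' : measure_display) (I : measurableType d') (lambda : probability I R)
    (Sigma : set (set (I * Omega)))
    (mu : probability (g_sigma_algebraType Sigma) R)
    (YI : I -> R -> Omega -> R)
    (hG : right_continuous_filtration G)
    (hc : 0 < c)
    (hF : forall t : R, 0 <= t -> continuous (F t))
    (hE : unit_exponential_independent G E)
    (hY : n_player_signals P G Y F)
    (hlambda : atomless lambda)
    (hmu : fubini_extension P lambda mu)
    (hYI : mean_field_signals P lambda G YI Sigma F)
    (hn : n_player_standing_assumptions P G r c Y E)
    (hmf : mean_field_standing_assumptions P lambda G YI r c E) :
  (forall D : set R, dense_in_Rplus D ->
   (forall t u, D t -> is_minimal_solution r c (F t) u ->
      increasing_transversal r c (F t) u) ->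
   forall (rho_ : nat -> R -> Omega -> R) (rho : R -> R),
   (forall n, (0 < n)%N -> minimal_n_player_equilibrium G r c Y n (rho_ n)) ->
   minimal_mean_field_equilibrium P lambda YI r c rho ->
   fatou_cvg_in_probability P rho_ rho) /\
  (forall D : set R, dense_in_Rplus D ->
   (forall t u, D t -> is_maximal_solution r c (F t) u ->
      increasing_transversal r c (F t) u) ->
   forall (rho_ : nat -> R -> Omega -> R) (rho : R -> R),
   (forall n, (0 < n)%N -> maximal_n_player_equilibrium G r c Y n (rho_ n)) ->
   maximal_mean_field_equilibrium P lambda YI r c rho ->
   fatou_cvg_in_probability P rho_ rho).
Proof.
have hY0 : signal_process G (Y 0) := hY.1 0.
have FY0 t : 0 <= t -> has_cdf P (Y 0 t) (F t).
  by move=> t0; exact: (hY.2 t t0).1.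
split=> D hD transversal rho_ rho hrho_ hrho; exists D; split=> // t Dt;
  have t0 : 0 <= t := hD.1 t Dt.
- have rho_min := minimal_mean_field_solution hG hc hF hmu hYI hY0 FY0 hrho t0
    (fun u => transversal t u Dt).
  exact: (minimal_equilibrium_cvg hG hc hY t0 (hF t t0) rho_min
    (transversal t _ Dt rho_min) hrho_).
- have rho_max := maximal_mean_field_solution hG hc hF hmu hYI hY0 FY0 hrho t0.
  exact: (maximal_equilibrium_cvg hG hc hY t0 (hF t t0) rho_max
    (transversal t _ Dt rho_max) hrho_).
Qed.
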